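(* Let $(G,X)$ be a strongly marked group with Property $\mathcal D$ and let $QD(\Gamma,m,f)$ be a quasi-Dyer presentation for $(G,X)$, with $X=\{x_v\mid v\in V(\Gamma)\}$. Let $U\subset V(\Gamma)$ and $Y=\{x_u\mid u\in U\}$, and let $G_Y$ be the subgroup of $G$ generated by $Y$. Then $(G_Y,Y)$ is a strongly marked group with Property $\mathcal D$ and $QD(\Gamma_U,m_U,f_U)$ is a quasi-Dyer presentation for $(G_Y,Y)$.
   Context: Notation. A marked group is a pair $(G,X)$ with $G$ a group and $X\subset G$ a generating set. $o(g)$ is the order of $g$; $\mathbb Z_{o(g)}=\mathbb Z/o(g)\mathbb Z$ if $o(g)$ is finite and $\mathbb Z_{o(g)}=\mathbb Z$ otherwise. The set of syllables is $S(X)=\{x^a\mid x\in X,\ a\in\mathbb Z_{o(x)}\setminus\{0\}\}$. $S(X)^*$ is the free monoid on $S(X)$; its elements are called syllabic words, written as finite sequences, with concatenation written $w\cdot w'$. For $w=(s_1,\dots,s_\ell)$, $\overline w=s_1\cdots s_\ell\in G$. The syllabic length $\lg_{S(X)}(g)$ is the shortest length of a syllabic word $w$ with $\overline w=g$; a word $w$ of length $\ell$ is reduced if $\ell=\lg_{S(X)}(\overline w)$. For $m\ge2$, $[a,b]_m$ is the alternating word $(a,b,a,\dots)$ of length $m$, and $\overline{[a,b]}_m$ is the alternating product $aba\cdots$ with $m$ factors. Strongly marked. $(G,X)$ is strongly marked if $1\notin X$ and, for all $x,y\in X$, $s\in\langle x\rangle\setminus\{1\}$, $t\in\langle y\rangle\setminus\{1\}$: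 if $st\in S(X)\cup\{1\}$ then $x=y$. M-operations. Type I: if $w=w_1\cdot(s,t)\cdot w_2$ with $s,t\in S(X)$ and $st\in S(X)\cup\{1\}$, replace $w$ by $w_1\cdot(st)\cdot w_2$ if $st\ne1$, and by $w_1\cdot w_2$ if $st=1$. Type II: if $w=w_1\cdot[s,t]_m\cdot w_2$ with $s,t\in S(X)$, $m\ge2$, $\overline{[s,t]}_m=\overline{[t,s]}_m$ and $\lg_{S(X)}(\overline{[s,t]}_m)=m$, replace $w$ by $w_1\cdot[t,s]_m\cdot w_2$. A word is M-reduced if its length cannot be shortened by any finite sequence of elementary M-operations. Property $\mathcal D$. $(G,X)$ has Property $\mathcal D$ if (a) every $w\in S(X)^*$ is reduced if and only if it is M-reduced, and (b) for all reduced $w,w'\in S(X)^*$ with $\overline w=\overline{w'}$, one can go from $w$ to $w'$ through a finite sequence of elementary M-operations of type II. Quasi-Dyer groups. Let $\Gamma$ be a simplicial graph (possibly infinite) with vertex set $V(\Gamma)$ and edge set $E(\Gamma)$, with maps $m:E(\Gamma)\to\mathbb N_{\ge2}$ and $f:V(\Gamma)\to\mathbb N_{\ge2}\cup\{\infty\}$ such that for each edge $e=\{u,v\}$: if $m(e)>2$ is even, then $f(u)=f(v)=2$; if $m(e)>2$ is odd, then $f(u)$ and $f(v)$ are both finite and even and at least one of them equals $2$. The quasi-Dyer group $QD(\Gamma,m,f)$ is the group with generators $x_v$ ($v\in V(\Gamma)$) and relations: $x_v^{f(v)}=1$ whenever $f(v)\ne\infty$; $x_ux_v=x_vx_u$ for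 all $e=\{u,v\}\in E(\Gamma)$ with $m(e)=2$; $\overline{[x_u^{f(u)/2},x_v^{f(v)/2}]}_{m(e)}=\overline{[x_v^{f(v)/2},x_u^{f(u)/2}]}_{m(e)}$ for all $e=\{u,v\}\in E(\Gamma)$ with $m(e)>2$. One says that $QD(\Gamma,m,f)$ is a quasi-Dyer presentation for $(G,X)$ if $G=QD(\Gamma,m,f)$ and $X=\{x_v\mid v\in V(\Gamma)\}$. (In the conclusion, the generator of $QD(\Gamma_U,m_U,f_U)$ indexed by $u\in U$ corresponds to $x_u\in Y$.) For $U\subset V(\Gamma)$, $\Gamma_U$ is the full subgraph of $\Gamma$ spanned by $U$, and $m_U$, $f_U$ are the restrictions of $m$ to $E(\Gamma_U)$ and of $f$ to $V(\Gamma_U)=U$. *)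

(* Defs.v *)
From HB Require Import structures.
From mathcomp Require Import all_boot all_order all_algebra.
From mathcomp Require Import boolp classical_sets.
From Stdlib Require Import Relation_Operators.

Set Implicit Arguments.
Unset Strict Implicit.
Unset Printing Implicit Defensive.

Local Open Scope classical_set_scope.
Local Open Scope quotient_scope.
Local Open Scope group_scope.

Definition gen (G : groupType) (A : set G) : set G :=
  smallest (fun H : set G => group_closed [in H]) A.

Lemma gen_closed (G : groupType) (A : set G) : group_closed [in gen A].
Proof.
split; first by apply/mem_set => H [[H1 _] _]; exact: set_mem.
move=> a b /set_mem Aa /set_mem Ab; apply/mem_set => H HA.
have [[_ HD] _] := HA.
by apply: set_mem; apply: HD; apply/mem_set; [apply: Aa | apply: Ab].
Qed.

Lemma sub_gen (G : groupType) (A : set G) : A `<=` gen A.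
Proof. exact: sub_smallest. Qed.

Record gen_group (G : groupType) (A : set G) :=
  GenGroup { gen_val : G; gen_valP : gen_val \in gen A }.

HB.instance Definition _ (G : groupType) (A : set G) :=
  [isSub for @gen_val G A].
HB.instance Definition _ (G : groupType) (A : set G) :=
  [Choice of gen_group A by <:].
HB.instance Definition _ (G : groupType) (A : set G) :=
  SubChoice_isSubGroup.Build G [in gen A] (gen_group A) (gen_closed A).

(* A, seen as a subset of the subgroup that it generates. *)
Definition gen_set (G : groupType) (A : set G) : set (gen_group A) :=
  [set g | A (val g)].
Arguments gen_set {G} A _.

(* The order of g, with the convention that it is 0 when g has infinite
   order, so that Z/(gorder g)Z is the index group Z_{o(g)} in all cases. *)
Definition gorder (G : groupType) (g : G) : nat :=
  match pselect (exists n, (0 < n)%N && (g ^+ n == 1)) with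
  | left h => ex_minn h
  | right _ => 0
  end.

Definition zexp (G : groupType) (g : G) (a : int) : G :=
  match a with Posz n => g ^+ n | Negz n => g ^- n.+1 end.

(* The exponent a ranges over integers representing a nonzero class modulo
   the order of x; recall that 0 %| a holds only if a = 0. *)
Definition syllable (G : groupType) (X : set G) : set G :=
  [set s | exists x (a : int),
     [/\ X x, ~~ ((gorder x)%:Z %| a)%Z & s = zexp x a]].

Definition syllabic (G : groupType) (X : set G) (w : seq G) : Prop :=
  forall s, s \in w -> syllable X s.

Definition weval (G : groupType) (w : seq G) : G := \prod_(s <- w) s.

(* The value 0 of the "right" branch is never used for a marked group. *)
Definition slength (G : groupType) (X : set G) (g : G) : nat :=
  match pselect (exists n,
    `[< exists w, [/\ syllabic X w, size w = n & weval w = g] >]) with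
  | left h => ex_minn h
  | right _ => 0
  end.

Definition reduced (G : groupType) (X : set G) (w : seq G) : Prop :=
  size w = slength X (weval w).

Fixpoint alternating (T : Type) (a b : T) (m : nat) : seq T :=
  if m is m'.+1 then a :: alternating b a m' else [::].

Definition marked (G : groupType) (X : set G) : Prop := gen X = [set: G].

Definition strongly_marked (G : groupType) (X : set G) : Prop :=
  [/\ marked X,
      ~ X 1
    & forall x y s t : G, X x -> X y ->
        gen [set x] s -> s <> 1 -> gen [set y] t -> t <> 1 ->
        syllable X (s * t) \/ s * t = 1 -> x = y].

Inductive Mop1 (G : groupType) (X : set G) : seq G -> seq G -> Prop :=
| Mop1_merge w1 w2 s t :
    syllable X s -> syllable X t -> syllable X (s * t) -> s * t <> 1 ->
    Mop1 X (w1 ++ [:: s; t] ++ w2) (w1 ++ [:: s * t] ++ w2)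
| Mop1_cancel w1 w2 s t :
    syllable X s -> syllable X t -> s * t = 1 ->
    Mop1 X (w1 ++ [:: s; t] ++ w2) (w1 ++ w2).

Inductive Mop2 (G : groupType) (X : set G) : seq G -> seq G -> Prop :=
| Mop2_swap w1 w2 s t m :
    syllable X s -> syllable X t -> (2 <= m)%N ->
    weval (alternating s t m) = weval (alternating t s m) ->
    slength X (weval (alternating s t m)) = m ->
    Mop2 X (w1 ++ alternating s t m ++ w2) (w1 ++ alternating t s m ++ w2).

Definition Mop (G : groupType) (X : set G) (w w' : seq G) : Prop :=
  Mop1 X w w' \/ Mop2 X w w'.

Definition Mreduced (G : groupType) (X : set G) (w : seq G) : Prop :=
  ~ exists2 w', clos_refl_trans _ (Mop X) w w' & (size w' < size w)%N.

Definition property_D (G : groupType) (X : set G) : Prop :=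
  (forall w, syllabic X w -> (reduced X w <-> Mreduced X w)) /\
  (forall w w', syllabic X w -> syllabic X w' ->
     reduced X w -> reduced X w' -> weval w = weval w' ->
     clos_refl_trans _ (Mop2 X) w w').

(* The letter (v, true) stands for the generator indexed by v, and (v, false)
   for its inverse. *)
Definition gword (V : Type) : Type := seq (V * bool).

Definition ginv (V : Type) (w : gword V) : gword V :=
  rev [seq (l.1, ~~ l.2) | l <- w].

Inductive pres_eq (V : Type) (R : gword V -> gword V -> Prop) :
    gword V -> gword V -> Prop :=
| pres_rel u v : R u v -> pres_eq R u v
| pres_free a b : pres_eq R [:: (a, b); (a, ~~ b)] [::]
| pres_cat u u' v v' :
    pres_eq R u u' -> pres_eq R v v' -> pres_eq R (u ++ v) (u' ++ v')
| pres_refl u : pres_eq R u u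
| pres_sym u v : pres_eq R u v -> pres_eq R v u
| pres_trans u v w : pres_eq R u v -> pres_eq R v w -> pres_eq R u w.

Definition pres_eqb (V : Type) (R : gword V -> gword V -> Prop) :
  rel {classic gword V} := fun u v => `[< pres_eq R u v >].

Lemma pres_eqb_equiv (V : Type) (R : gword V -> gword V -> Prop) :
  equiv_class_of (pres_eqb R).
Proof.
split=> [u|u v|v u w]; first exact/asboolP/pres_refl.
  by apply/asboolP/asboolP => /pres_sym.
by move=> /asboolP uv /asboolP vw; apply/asboolP/(pres_trans uv vw).
Qed.

Canonical pres_equiv_rel (V : Type) (R : gword V -> gword V -> Prop) :=
  EquivRelPack (pres_eqb_equiv R).

(* The group <V | u = v for R u v>. *)
Definition presented (V : Type) (R : gword V -> gword V -> Prop) : Type :=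
  {eq_quot pres_eqb R}.

HB.instance Definition _ (V : Type) (R : gword V -> gword V -> Prop) :=
  Choice.on (presented R).
HB.instance Definition _ (V : Type) (R : gword V -> gword V -> Prop) :=
  EqQuotient.on (presented R).

Definition pres_class (V : Type) (R : gword V -> gword V -> Prop)
  (w : gword V) : presented R := \pi_(presented R) (w : {classic gword V}).

Definition pres_repr (V : Type) (R : gword V -> gword V -> Prop)
  (g : presented R) : gword V := repr g.

Lemma pres_reprK (V : Type) (R : gword V -> gword V -> Prop)
  (g : presented R) : pres_class R (pres_repr g) = g.
Proof. exact: reprK. Qed.

Lemma pres_classP (V : Type) (R : gword V -> gword V -> Prop)
  (u v : gword V) : pres_class R u = pres_class R v <-> pres_eq R u v.
Proof. by split=> [/eqmodP/asboolP|uv]; last exact/eqmodP/asboolP. Qed.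

Lemma pres_reprP (V : Type) (R : gword V -> gword V -> Prop) (u : gword V) :
  pres_eq R (pres_repr (pres_class R u)) u.
Proof. exact/pres_classP/pres_reprK. Qed.

Definition pres_mul (V : Type) (R : gword V -> gword V -> Prop)
  (g h : presented R) := pres_class R (pres_repr g ++ pres_repr h).

Definition pres_inv (V : Type) (R : gword V -> gword V -> Prop)
  (g : presented R) := pres_class R (ginv (pres_repr g)).

Lemma ginvK (V : Type) : involutive (@ginv V).
Proof.
move=> w; rewrite /ginv map_rev revK -map_comp -[RHS]map_id.
by apply: eq_map => -[a b] /=; rewrite negbK.
Qed.

Lemma pres_invr (V : Type) (R : gword V -> gword V -> Prop) (w : gword V) :
  pres_eq R (w ++ ginv w) [::].
Proof.
elim: w => [|[a b] w IHw]; first exact: pres_refl.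
rewrite /ginv /= rev_cons -cats1 catA -/(ginv w).
apply: pres_trans (pres_free R a b).
apply: (@pres_cat _ _ [:: (a, b)] [:: (a, b)]); first exact: pres_refl.
by apply: (@pres_cat _ _ _ [::] _ _ IHw); exact: pres_refl.
Qed.

Lemma pres_mulA (V : Type) (R : gword V -> gword V -> Prop) :
  associative (@pres_mul V R).
Proof.
move=> x y z; apply/pres_classP.
apply: (@pres_trans _ _ _ (pres_repr x ++ pres_repr y ++ pres_repr z)).
  by apply: pres_cat; [exact: pres_refl | exact: pres_reprP].
rewrite catA; apply/pres_sym.
by apply: pres_cat; [exact: pres_reprP | exact: pres_refl].
Qed.

Lemma pres_mul1 (V : Type) (R : gword V -> gword V -> Prop) :
  left_id (pres_class R [::]) (@pres_mul V R).
Proof.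
move=> x; rewrite -[RHS]pres_reprK; apply/pres_classP.
rewrite -[X in pres_eq _ _ X]cat0s.
by apply: pres_cat; [exact: pres_reprP | exact: pres_refl].
Qed.

Lemma pres_mulr1 (V : Type) (R : gword V -> gword V -> Prop) :
  right_id (pres_class R [::]) (@pres_mul V R).
Proof.
move=> x; rewrite -[RHS]pres_reprK; apply/pres_classP.
rewrite -[X in pres_eq _ _ X]cats0.
by apply: pres_cat; [exact: pres_refl | exact: pres_reprP].
Qed.

Lemma pres_mulrV (V : Type) (R : gword V -> gword V -> Prop) :
  right_inverse (pres_class R [::]) (@pres_inv V R) (@pres_mul V R).
Proof.
move=> x; apply/pres_classP; apply: pres_trans (pres_invr R (pres_repr x)).
by apply: pres_cat; [exact: pres_refl | exact: pres_reprP].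
Qed.

Lemma pres_mulV (V : Type) (R : gword V -> gword V -> Prop) :
  left_inverse (pres_class R [::]) (@pres_inv V R) (@pres_mul V R).
Proof.
move=> x; apply/pres_classP.
apply: pres_trans (pres_invr R (ginv (pres_repr x))); rewrite ginvK.
by apply: pres_cat; [exact: pres_reprP | exact: pres_refl].
Qed.

HB.instance Definition _ (V : Type) (R : gword V -> gword V -> Prop) :=
  isGroup.Build (presented R) (@pres_mulA V R) (@pres_mul1 V R)
    (@pres_mulr1 V R) (@pres_mulV V R) (@pres_mulrV V R).

Definition pres_gen (V : Type) (R : gword V -> gword V -> Prop) (v : V) :
  presented R := pres_class R [:: (v, true)].

(* The edge labels are given by a symmetric function, whose values at pairs
   of non-adjacent vertices are irrelevant; the vertex label None stands for
   the label infinity. *)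
Record qd_graph (V : Type) := QDGraph {
  qd_adj : V -> V -> Prop;
  qd_adj_sym : forall u v, qd_adj u v -> qd_adj v u;
  qd_adj_irr : forall v, ~ qd_adj v v;
  qd_m : V -> V -> nat;
  qd_m_sym : forall u v, qd_adj u v -> qd_m u v = qd_m v u;
  qd_m_ge2 : forall u v, qd_adj u v -> (2 <= qd_m u v)%N;
  qd_f : V -> option nat;
  qd_f_ge2 : forall v n, qd_f v = Some n -> (2 <= n)%N;
  qd_even : forall u v, qd_adj u v -> (2 < qd_m u v)%N -> ~~ odd (qd_m u v) ->
    qd_f u = Some 2 /\ qd_f v = Some 2;
  qd_odd : forall u v, qd_adj u v -> (2 < qd_m u v)%N -> odd (qd_m u v) ->
    exists p q, [/\ qd_f u = Some p, qd_f v = Some q, ~~ odd p, ~~ odd q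
                  & p = 2 \/ q = 2]
}.

Definition gpow (V : Type) (v : V) (n : nat) : gword V := nseq n (v, true).

Inductive qd_rel (V : Type) (Gamma : qd_graph V) :
    gword V -> gword V -> Prop :=
| qd_rel_order v n :
    qd_f Gamma v = Some n -> qd_rel Gamma (gpow v n) [::]
| qd_rel_comm u v :
    qd_adj Gamma u v -> qd_m Gamma u v = 2 ->
    qd_rel Gamma (gpow u 1 ++ gpow v 1) (gpow v 1 ++ gpow u 1)
| qd_rel_braid u v p q :
    qd_adj Gamma u v -> (2 < qd_m Gamma u v)%N ->
    qd_f Gamma u = Some p -> qd_f Gamma v = Some q ->
    qd_rel Gamma
      (flatten (alternating (gpow u p./2) (gpow v q./2) (qd_m Gamma u v)))
      (flatten (alternating (gpow v q./2) (gpow u p./2) (qd_m Gamma u v))).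

Definition QD (V : Type) (Gamma : qd_graph V) : groupType :=
  presented (qd_rel Gamma).

Definition qd_gen (V : Type) (Gamma : qd_graph V) (v : V) : QD Gamma :=
  pres_gen (qd_rel Gamma) v.

(* G = QD(Gamma, m, f) with X = {x_v | v in V(Gamma)}: the group is identified
   with the presented one in such a way that x_v is the generator of index v. *)
Definition qd_presentation (V : Type) (Gamma : qd_graph V)
    (G : groupType) (X : set G) (x : V -> G) : Prop :=
  X = range x /\
  exists phi : {multiplicative QD Gamma -> G},
    bijective phi /\ forall v, phi (qd_gen Gamma v) = x v.

Definition qd_restrict (V : Type) (Gamma : qd_graph V) (U : set V) :
  qd_graph U :=
  @QDGraph U
    (fun u v => qd_adj Gamma (val u) (val v))
    (fun u v => @qd_adj_sym V Gamma (val u) (val v))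
    (fun v => @qd_adj_irr V Gamma (val v))
    (fun u v => qd_m Gamma (val u) (val v))
    (fun u v => @qd_m_sym V Gamma (val u) (val v))
    (fun u v => @qd_m_ge2 V Gamma (val u) (val v))
    (fun v => qd_f Gamma (val v))
    (fun v => @qd_f_ge2 V Gamma (val v))
    (fun u v => @qd_even V Gamma (val u) (val v))
    (fun u v => @qd_odd V Gamma (val u) (val v)).

Lemma gen_image_in (V : Type) (G : groupType) (x : V -> G) (U : set V)
  (u : U) : x (val u) \in gen (x @` U).
Proof. exact: mem_set (sub_gen (imageP x (set_valP u))). Qed.

Definition gen_family (V : Type) (G : groupType) (x : V -> G) (U : set V)
  (u : U) : gen_group (x @` U) := GenGroup (gen_image_in x u).
Arguments gen_family {V G} x U u.

(* Main.v *)
(** The group [QD(Gamma, m, f)] acts on the functions [V * bool -> F[T]]: the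
    generator [x_v] is sent to [preflection v z (z ^ 2)], where [z] is a primitive
    [f(v)]-th root of unity ([2] if [f(v)] is infinite).  It scales the coordinate
    [(v, false)] by [z] and the coordinate [(v, true)] by [z ^ 2], so that
    [x_v ^ (f(v) / 2)] is a reflection along [(v, false)] only; the relations then
    hold as for the geometric representation of a Coxeter group, and the
    coefficients which they do not constrain may be set to the indeterminate [T].
    The action gives the orders of the generators and of the products of two
    reflections, and a ping-pong on degrees in [T] excludes every alternating
    relation between two syllables which does not follow from the defining
    relations involving these two generators.

    On the other hand M-operations never leave the words over [Y], because
    [(G, X)] is strongly marked.  Hence syllabic lengths in [G_Y] and in [G]
    agree, and Property D is inherited.  A syllabic word over [Y] representing
    [1] is turned into the empty word by M-operations, each of which is a
    consequence of the relations of [QD(Gamma_U)] by the first part. *)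
From HB Require Import structures.
Require Import Defs.
From mathcomp Require Import all_boot all_order all_algebra all_field.
From mathcomp Require Import boolp classical_sets.
From mathcomp Require Import zify ring.
From Stdlib Require Import Relation_Operators Operators_Properties.

Set Implicit Arguments.
Unset Strict Implicit.
Unset Printing Implicit Defensive.

Import Order.TTheory GRing.Theory Num.Theory.

Local Open Scope classical_set_scope.
Local Open Scope group_scope.

(** * Integer powers and the order of an element *)

Section Zexp.
Variable G : groupType.
Implicit Types g h : G.

Lemma zexp_nat g n : zexp g (Posz n) = g ^+ n.
Proof. by []. Qed.

Lemma zexpN g a : zexp g (- a)%R = (zexp g a)^-1.
Proof.
by case: a => [[|n]|n]; rewrite /zexp /= ?invg1 ?invgK.
Qed.

Lemma zexp_subn g m n : zexp g (m%:Z - n%:Z)%R = g ^+ m * g ^- n.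
Proof.
case: (leqP n m) => [nm|mn].
  by rewrite subzn // zexp_nat expgnFr.
rewrite -opprB subzn 1?ltnW // zexpN zexp_nat expgnFr 1?ltnW //.
by rewrite invgM invgK.
Qed.

Lemma int_subn (a : int) : exists m n, a = (m%:Z - n%:Z)%R.
Proof.
case: a => n; first by exists n, 0%N; rewrite subr0.
by exists 0%N, n.+1; rewrite NegzE sub0r.
Qed.

Lemma zexpD g a b : zexp g (a + b)%R = zexp g a * zexp g b.
Proof.
have [m [n ->]] := int_subn a; have [k [l ->]] := int_subn b.
have -> : (m%:Z - n%:Z + (k%:Z - l%:Z) = (m + k)%N%:Z - (n + l)%N%:Z)%R by lia.
rewrite !zexp_subn !expgnDr invgM -!mulgA; congr (_ * _).
have c i j : commute (g ^+ i) (g ^+ j) by exact: commuteX2.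
rewrite -invgM -expgnDr addnC expgnDr invgM !mulgA; congr (_ * _).
exact/esym/commute_sym/commuteV/c.
Qed.

Lemma zexpB g a b : zexp g (a - b)%R = zexp g a * (zexp g b)^-1.
Proof. by rewrite zexpD zexpN. Qed.

Lemma commute_zexp g h a b : commute g h -> commute (zexp g a) (zexp h b).
Proof.
move=> gh; have c m n : commute (g ^+ m) (h ^+ n) by exact: commuteX2.
have cV k l : commute (k : G) l -> commute k l^-1 by exact: commuteV.
case: a b => m [] n; rewrite /zexp; first exact: c.
- exact/cV/c.
- exact/commute_sym/cV/commute_sym/c.
- exact/cV/commute_sym/cV/commute_sym/c.
Qed.

Lemma zexpM g a b : zexp g (a * b)%R = zexp (zexp g a) b.
Proof.
have nat n : zexp g (a * n%:Z)%R = zexp g a ^+ n.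
  elim: n => [|n IHn]; first by rewrite mulr0.
  by rewrite -addn1 PoszD mulrDr mulr1 zexpD IHn expgnDr expg1.
case: b => n; first exact: nat.
rewrite NegzE mulrN !zexpN nat //.
Qed.

Lemma zexp1 a : zexp (1 : G) a = 1.
Proof. by case: a => n; rewrite /zexp expg1n ?invg1. Qed.

Lemma zexp_dvd g n a : g ^+ n = 1 -> (n%:Z %| a)%Z -> zexp g a = 1.
Proof. by move=> gn /dvdzP[b ->]; rewrite mulrC zexpM zexp_nat gn zexp1. Qed.

(** A nonzero remainder of [a] modulo the least positive period would be a smaller period; with no
    period, [gorder g] is [0], which divides only [0]. *)
Lemma zexp_eq1 g a : zexp g a = 1 <-> ((gorder g)%:Z %| a)%Z.
Proof.
rewrite /gorder; case: pselect => [h|h].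
  case: ex_minnP => n /andP[n0 /eqP gn] min; split; last exact: zexp_dvd.
  move=> ga; have : zexp g (modz a n%:Z) = 1.
    by rewrite /modz zexpB ga mulrC zexpM zexp_nat gn zexp1 invg1 mulg1.
  have: (0 <= modz a n%:Z)%R by rewrite modz_ge0 // -lt0n.
  have: (modz a n%:Z < n%:Z)%R by rewrite ltz_pmod.
  case E: (modz a n%:Z) => [r|//] rn _ gr.
  apply/dvdz_mod0P; rewrite E; case: r => // r in E rn gr *.
  by have := min r.+1; rewrite /= -zexp_nat gr eqxx => /(_ isT); lia.
split=> [ga|]; last by rewrite dvd0z => /eqP->.
rewrite dvd0z; apply/negP => /negP a0; apply: h; exists `|a|%N.
rewrite absz_gt0 a0 /= -zexp_nat; apply/eqP.
by case: (a) ga => n //= /eqP; rewrite invg_eq1 => /eqP.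
Qed.
End Zexp.

(** * Homomorphisms given as bare functions *)

Section Morphisms.
Variables (G H : groupType) (f : G -> H).
Hypothesis fM : {morph f : x y / x * y}.

Lemma morph_1 : f 1 = 1.
Proof. by apply: (mulgI (f 1)); rewrite -fM !mulg1. Qed.

Lemma morph_V : {morph f : x / x^-1}.
Proof. by move=> x; apply: (mulgI (f x)); rewrite -fM !mulgV morph_1. Qed.

Lemma morph_X n : {morph f : x / x ^+ n}.
Proof.
by elim: n => [|n IHn] x; rewrite ?expg0 ?morph_1 // !expgS fM IHn.
Qed.

Lemma morph_zexp a : {morph f : x / zexp x a}.
Proof. by case: a => n x /=; rewrite ?morph_V morph_X. Qed.

Lemma morph_weval w : f (weval w) = weval (map f w).
Proof.
by rewrite /weval big_map; apply: big_morph; [exact: fM|exact: morph_1].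
Qed.
End Morphisms.

Lemma map_alternating (T T' : Type) (f : T -> T') s t m :
  map f (alternating s t m) = alternating (f s) (f t) m.
Proof. by elim: m s t => //= m IHm s t; rewrite IHm. Qed.

Lemma mem_alternating (T : eqType) (s t r : T) m :
  r \in alternating s t m -> r = s \/ r = t.
Proof.
elim: m s t => //= m IHm s t; rewrite inE => /orP[/eqP->|/IHm[]]; tauto.
Qed.

(** * Alternating products *)

Section Weval.
Variable G : groupType.
Implicit Types s t : G.

Lemma weval_cons s w : weval (s :: w) = s * weval w.
Proof. by rewrite /weval big_cons. Qed.

Lemma weval_nil : weval [::] = 1 :> G.
Proof. by rewrite /weval big_nil. Qed.

Lemma weval_cat (w w' : seq G) : weval (w ++ w') = weval w * weval w'.
Proof. by rewrite /weval big_cat. Qed.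

Lemma weval_alternatingS s t m :
  weval (alternating s t m.+1) = s * weval (alternating t s m).
Proof. exact: weval_cons. Qed.

Lemma weval_alternating_commute s t m :
  commute s t -> weval (alternating s t m) = s ^+ uphalf m * t ^+ m./2.
Proof.
elim: m s t => [|m IHm] s t st /=; first by rewrite weval_nil mulg1.
rewrite weval_cons IHm; last exact: commute_sym.
have -> : t ^+ uphalf m * s ^+ m./2 = s ^+ m./2 * t ^+ uphalf m.
  by apply: commuteX2; apply: commute_sym.
by rewrite mulgA -expgS.
Qed.

(** For odd [m] the two products differ only in which letter has the larger exponent, and cancelling
    the common powers leaves [s = t]. *)
Lemma commute_alternating s t m : commute s t -> s <> t ->
  weval (alternating s t m) = weval (alternating t s m) -> ~~ odd m.
Proof.
move=> st neq; have ts := commute_sym st.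
rewrite !weval_alternating_commute //.
apply: contraPN => mo; rewrite uphalf_half mo add1n !expgS => E; apply: neq.
move: E; rewrite -mulgA -[in RHS]mulgA.
have -> : t ^+ m./2 * s ^+ m./2 = s ^+ m./2 * t ^+ m./2.
  by apply: commuteX2.
exact: mulIg.
Qed.

Lemma even_alternating_commute s t m : commute s t -> ~~ odd m ->
  weval (alternating s t m) = weval (alternating t s m).
Proof.
move=> st me; have ts := commute_sym st.
rewrite !weval_alternating_commute //.
rewrite uphalf_half (negbTE me) add0n; exact: commuteX2.
Qed.

(** The inverse of an alternating product of involutions is the same product read backwards, so the
    quotient of the two sides is [(s * t) ^+ m]. *)
Lemma alternating_involutions s t m : s * s = 1 -> t * t = 1 ->
  weval (alternating s t m) = weval (alternating t s m) <->
  (s * t) ^+ m = 1.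
Proof.
move=> ss tt.
suff <- : weval (alternating s t m) / weval (alternating t s m) =
          (s * t) ^+ m.
  by split=> [->|/divg1_eq //]; rewrite mulgV.
have tV (r : G) : r * r = 1 -> r^-1 = r by exact: mulg1_eq.
have shift (a b : G) k : a * (b * a) ^+ k * b = (a * b) ^+ k.+1.
  elim: k a b => [|k IHk] a b; first by rewrite expg0 mulg1 expg1.
  by rewrite expgSr !mulgA IHk -mulgA -expgSr.
elim: m s t ss tt => [|m IHm] s t ss tt; first by rewrite /= weval_nil mulgV.
by rewrite /= !weval_cons invgM mulgA -(mulgA s) IHm // (tV t tt) shift.
Qed.
End Weval.

(** * Homomorphisms out of a quasi-Dyer group *)

Section Presentations.
Variables (V : Type) (Gamma : qd_graph V).

Definition qd_relations (H : groupType) (y : V -> H) : Prop :=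
  [/\ forall v n, qd_f Gamma v = Some n -> y v ^+ n = 1,
      forall u v, qd_adj Gamma u v -> qd_m Gamma u v = 2 ->
        commute (y u) (y v)
    & forall u v p q, qd_adj Gamma u v -> (2 < qd_m Gamma u v)%N ->
        qd_f Gamma u = Some p -> qd_f Gamma v = Some q ->
        weval (alternating (y u ^+ p./2) (y v ^+ q./2) (qd_m Gamma u v)) =
        weval (alternating (y v ^+ q./2) (y u ^+ p./2) (qd_m Gamma u v))].

Definition geval (H : groupType) (y : V -> H) (w : gword V) : H :=
  weval [seq if l.2 then y l.1 else (y l.1)^-1 | l <- w].

Lemma geval_cat (H : groupType) (y : V -> H) w w' :
  geval y (w ++ w') = geval y w * geval y w'.
Proof. by rewrite /geval map_cat weval_cat. Qed.

Lemma geval_nil (H : groupType) (y : V -> H) : geval y [::] = 1.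
Proof. exact: weval_nil. Qed.

Lemma geval_letter (H : groupType) (y : V -> H) v b :
  geval y [:: (v, b)] = if b then y v else (y v)^-1.
Proof. by rewrite /geval /= weval_cons weval_nil mulg1. Qed.

Lemma geval_gpow (H : groupType) (y : V -> H) v n :
  geval y (gpow v n) = y v ^+ n.
Proof.
elim: n => [|n IHn]; first exact: geval_nil.
by rewrite expgS -IHn /geval /= weval_cons.
Qed.

Lemma geval_flatten (H : groupType) (y : V -> H) (ws : seq (gword V)) :
  geval y (flatten ws) = weval [seq geval y w | w <- ws].
Proof.
elim: ws => [|w ws IHws] /=; first by rewrite weval_nil geval_nil.
by rewrite geval_cat weval_cons IHws.
Qed.

Lemma geval_pres_eq (H : groupType) (y : V -> H) w w' :
  qd_relations y -> pres_eq (qd_rel Gamma) w w' -> geval y w = geval y w'.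
Proof.
move=> [yf y2 yb]; elim=> {w w'}.
- move=> _ _ [v n fv|u v uv m2|u v p q uv m2 fu fv].
  + by rewrite geval_gpow geval_nil; exact: yf fv.
  + rewrite !geval_cat !geval_gpow !expg1; exact: y2.
  + rewrite !geval_flatten !map_alternating !geval_gpow; exact: yb.
- move=> v b; rewrite -cat1s geval_cat !geval_letter geval_nil.
  by case: b; rewrite ?mulgV ?mulVg.
- by move=> u u' v v' _ IHu _ IHv; rewrite !geval_cat IHu IHv.
- by [].
- by move=> u v _ ->.
- by move=> u v w _ -> _ ->.
Qed.

Lemma pres_class_cat (R : gword V -> gword V -> Prop) w w' :
  pres_class R (w ++ w') = pres_class R w * pres_class R w'.
Proof.
by apply/esym/pres_classP; apply: pres_cat; exact: pres_reprP.
Qed.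

Lemma pres_classE w : pres_class (qd_rel Gamma) w = geval (qd_gen Gamma) w.
Proof.
elim: w => [|[v b] w IHw]; first by rewrite geval_nil.
rewrite -cat1s pres_class_cat geval_cat -IHw geval_letter; congr (_ * _).
case: b => //.
apply: (mulgI (qd_gen Gamma v)); rewrite mulgV -pres_class_cat.
by apply/pres_classP; exact: (pres_free _ v true).
Qed.

Lemma qd_gen_relations : qd_relations (qd_gen Gamma).
Proof.
have cl w w' : qd_rel Gamma w w' ->
    geval (qd_gen Gamma) w = geval (qd_gen Gamma) w'.
  by move=> ww'; rewrite -!pres_classE; apply/pres_classP/pres_rel.
split=> [v n fv|u v uv m2|u v p q uv m2 fu fv].
- by have := cl _ _ (qd_rel_order fv); rewrite geval_gpow geval_nil.
- by have := cl _ _ (qd_rel_comm uv m2); rewrite !geval_cat !geval_gpow !expg1.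
- have := cl _ _ (qd_rel_braid uv m2 fu fv).
  by rewrite !geval_flatten !map_alternating !geval_gpow.
Qed.

(** Von Dyck's theorem: [geval y] respects [pres_eq], so the value does not depend on the
    representing word. *)
Lemma qd_hom (H : groupType) (y : V -> H) : qd_relations y ->
  exists2 f : QD Gamma -> H, {morph f : g h / g * h} &
    forall v, f (qd_gen Gamma v) = y v.
Proof.
move=> yR; pose f (g : QD Gamma) := geval y (pres_repr g).
have fE w : f (pres_class _ w) = geval y w.
  by apply: geval_pres_eq => //; exact: pres_reprP.
exists f => [g h|v]; last by rewrite fE geval_letter.
by rewrite -[g]pres_reprK -[h]pres_reprK -pres_class_cat !fE geval_cat.
Qed.

Lemma morph_qd_relations (H K : groupType) (f : H -> K) (y : V -> H) :
  {morph f : g h / g * h} -> qd_relations y -> qd_relations (f \o y).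
Proof.
move=> fM [yf y2 yb]; split=> /= [v n fv|u v uv m2|u v p q uv m2 fu fv].
- by rewrite -morph_X // (yf v n) // morph_1.
- by rewrite /commute -!fM (y2 u v).
- rewrite -!(morph_X fM) -!map_alternating -!morph_weval //.
  by congr (f _); exact: yb.
Qed.

Lemma inj_qd_relations (H K : groupType) (f : H -> K) (y : V -> H) :
  {morph f : g h / g * h} -> injective f ->
  qd_relations (f \o y) -> qd_relations y.
Proof.
move=> fM fI [yf y2 yb]; split=> [v n fv|u v uv m2|u v p q uv m2 fu fv].
- by apply: fI; rewrite morph_X // morph_1 // (yf v n).
- by apply: fI; rewrite !fM; exact: y2.
- apply: fI; rewrite !(morph_weval fM) !map_alternating !(morph_X fM).
  exact: yb.
Qed.
End Presentations.

(** * Permutation groups and ping-pong *)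

Section Bijections.
Variable S : Type.

Record bij := Bij {
  bij_fun : S -> S;
  bij_inv : S -> S;
  bij_funK : cancel bij_fun bij_inv;
  bij_invK : cancel bij_inv bij_fun
}.

HB.instance Definition _ := gen_eqMixin bij.
HB.instance Definition _ := gen_choiceMixin bij.

Lemma bij_ext (f g : bij) : bij_fun f =1 bij_fun g -> f = g.
Proof.
case: f g => [f f' fK f'K] [g g' gK g'K] /= fg.
have E : f = g by exact/funext.
have E' : f' = g' by apply/funext => x; rewrite -[LHS]gK -E f'K.
by subst; congr Bij; exact: Prop_irrelevance.
Qed.

Definition bij_one := @Bij id id (fun=> erefl) (fun=> erefl).
Definition bij_mul (f g : bij) :=
  Bij (can_comp (bij_funK f) (bij_funK g)) (can_comp (bij_invK g) (bij_invK f)).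
Definition bij_opp (f : bij) := Bij (bij_invK f) (bij_funK f).

Lemma bij_mulA : associative bij_mul.
Proof. by move=> f g h; exact: bij_ext. Qed.
Lemma bij_mul1 : left_id bij_one bij_mul.
Proof. by move=> f; exact: bij_ext. Qed.
Lemma bij_mulr1 : right_id bij_one bij_mul.
Proof. by move=> f; exact: bij_ext. Qed.
Lemma bij_mulV : left_inverse bij_one bij_opp bij_mul.
Proof. by move=> f; apply: bij_ext => x /=; exact: bij_funK. Qed.
Lemma bij_mulrV : right_inverse bij_one bij_opp bij_mul.
Proof. by move=> f; apply: bij_ext => x /=; exact: bij_invK. Qed.

HB.instance Definition _ :=
  isGroup.Build bij bij_mulA bij_mul1 bij_mulr1 bij_mulV bij_mulrV.

Lemma bij_mulE (f g : bij) x : bij_fun (f * g) x = bij_fun f (bij_fun g x).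
Proof. by []. Qed.
End Bijections.

(** The leftmost letter acts last: by simultaneous induction the product starting with [s] sends [x]
    into [P] and the one starting with [t] sends it into [Q], which is disjoint from [P]. *)
Lemma ping_pong (S : Type) (s t : bij S) (P Q : S -> Prop) x m :
  P (bij_fun s x) -> Q (bij_fun t x) ->
  (forall y, Q y -> P (bij_fun s y)) -> (forall y, P y -> Q (bij_fun t y)) ->
  (forall y, P y -> ~ Q y) -> (0 < m)%N ->
  weval (alternating s t m) <> weval (alternating t s m).
Proof.
move=> Ps Qt QP PQ PnQ; case: m => // m _ E.
have [PA QA] : P (bij_fun (weval (alternating s t m.+1)) x) /\
               Q (bij_fun (weval (alternating t s m.+1)) x).
  elim: m {E} => [|m [IHP IHQ]].
    by rewrite /= !weval_cons !weval_nil !mulg1.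
  by split; rewrite weval_alternatingS bij_mulE; [apply: QP|apply: PQ].
by apply: (PnQ _ PA); rewrite E.
Qed.

(** * The reflection representation over polynomials *)

Section Representation.
Local Open Scope ring_scope.
Variables (V : Type) (Gamma : qd_graph V) (F : fieldType).
Variables (zeta : V -> F) (eta : nat -> F).
Hypothesis zetaP :
  forall v n, qd_f Gamma v = Some n -> n.-primitive_root (zeta v).
Hypothesis zeta_inf :
  forall v n, qd_f Gamma v = None -> (0 < n)%N -> zeta v ^+ n != 1.
Hypothesis zeta_neq0 : forall v, zeta v != 0.
Hypothesis etaP : forall M, (2 < M)%N -> (M.*2).-primitive_root (eta M).

Local Notation R := {poly F}.

(* Along an edge of label [M > 2] the entry at [(false, false)] plays the role of
   the cosine of [pi / M]; the powers of [x_v] other than [x_v ^ (f(v) / 2)] are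
   detected through the entries involving [(v, true)]. *)
Definition form (w : V) (i : bool) (v : V) (j : bool) : R :=
  if `[< w = v >] then (i == j)%:R
  else if `[< qd_adj Gamma w v >] then
    let M := qd_m Gamma w v in
    if (M <= 2)%N then 0
    else if i && j then 0
    else if i || j then 'X else ((eta M + (eta M)^-1) / 2)%:P
  else if i || j then 0 else 'X.

(** The composite of two pseudo-reflections, along [(v, false)] with factor [a] and along
    [(v, true)] with factor [b]; they commute because [form] is the identity on the block of [v]. *)
Definition preflection (v : V) (a b : R) (phi : V -> bool -> R) :
    V -> bool -> R :=
  fun w i => phi w i - (1 - a) * form w i v false * phi v false
                     - (1 - b) * form w i v true * phi v true.

Lemma form_same v i j : form v i v j = (i == j)%:R.
Proof. by rewrite /form asboolT. Qed.

Lemma adj_neq u v : qd_adj Gamma u v -> u <> v.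
Proof. by move=> /[swap] <-; exact: qd_adj_irr. Qed.

Lemma form_comm u v i j : qd_adj Gamma u v -> qd_m Gamma u v = 2 ->
  form u i v j = 0.
Proof.
by move=> uv m2; rewrite /form asboolF ?asboolT ?m2 //; exact: adj_neq.
Qed.

Lemma form_braid u v i j : qd_adj Gamma u v -> (2 < qd_m Gamma u v)%N ->
  form u i v j = if i && j then 0 else if i || j then 'X else
    ((eta (qd_m Gamma u v) + (eta (qd_m Gamma u v))^-1) / 2)%:P.
Proof.
move=> uv m2; rewrite /form asboolF ?asboolT //=; last exact: adj_neq.
by rewrite leqNgt m2.
Qed.

Lemma form_free u v i j : u <> v -> ~ qd_adj Gamma u v ->
  form u i v j = if i || j then 0 else 'X.
Proof. by move=> uv nuv; rewrite /form !asboolF. Qed.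

Lemma preflectionM v a b a' b' phi :
  preflection v a b (preflection v a' b' phi) =
  preflection v (a * a') (b * b') phi.
Proof.
apply/funext => w; apply/funext => i; rewrite /preflection !form_same /=; ring.
Qed.

Lemma preflection1 v phi : preflection v 1 1 phi = phi.
Proof.
apply/funext => w; apply/funext => i; rewrite /preflection; ring.
Qed.

Lemma preflectionK v (z z' : F) : z * z' = 1 ->
  cancel (preflection v z%:P (z ^+ 2)%:P) (preflection v z'%:P (z' ^+ 2)%:P).
Proof.
move=> zz' phi; rewrite preflectionM -!polyCM -exprMn (mulrC z') zz'.
by rewrite expr1n preflection1.
Qed.

Definition reflection (v : V) : bij (V -> bool -> R) :=
  Bij (@preflectionK v _ _ (divff (zeta_neq0 v)))
      (@preflectionK v _ _ (mulVf (zeta_neq0 v))).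

Lemma reflection_exp v n phi : bij_fun (reflection v ^+ n)%g phi =
  preflection v (zeta v ^+ n)%:P ((zeta v ^+ n) ^+ 2)%:P phi.
Proof.
elim: n phi => [|n IHn] phi; first by rewrite expr0 expr1n preflection1.
rewrite expgS bij_mulE IHn /= preflectionM -!polyCM.
by rewrite -exprMn -exprS.
Qed.

Lemma reflection_zexp v a phi : bij_fun (zexp (reflection v) a) phi =
  preflection v (zeta v ^ a)%:P ((zeta v ^ a) ^+ 2)%:P phi.
Proof.
case: a => n; first exact: reflection_exp.
rewrite /zexp; apply: (can_inj (bij_funK (reflection v ^+ n.+1)%g)).
rewrite -bij_mulE mulgV /= reflection_exp preflectionM NegzE -!polyCM -exprMn.
by rewrite -exprnN divff ?expr1n ?preflection1 // expf_neq0.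
Qed.

Lemma zeta_expz_eq1 v a : zeta v ^ a = 1 ->
  if qd_f Gamma v is Some n then (n%:Z %| a)%Z else a == 0.
Proof.
have nat n : zeta v ^+ n = 1 ->
    if qd_f Gamma v is Some k then (k %| n)%N else n == 0%N.
  case fv: (qd_f Gamma v) => [k|] /eqP.
    by rewrite (prim_order_dvd (zetaP fv)).
  by case: n => // n; rewrite (negbTE (zeta_inf fv (ltn0Sn n))).
case: a => n zn; first by move: (nat n zn); case: (qd_f _ _).
have /nat : zeta v ^+ n.+1 = 1.
  by move/(congr1 (@GRing.inv F)): zn; rewrite NegzE -exprnN invrK invr1.
by case: (qd_f _ _).
Qed.

Lemma preflection_self v a b phi i :
  preflection v a b phi v i = (if i then b else a) * phi v i.
Proof. rewrite /preflection !form_same; case: i => /=; ring. Qed.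

Lemma reflection_zexp_eq1 v a : zexp (reflection v) a = 1%g -> zeta v ^ a = 1.
Proof.
move=> E; have := reflection_zexp v a (fun _ _ => 1); rewrite E /=.
move=> /(congr1 (fun phi => phi v false)); rewrite preflection_self mulr1.
by move=> /esym/polyC_inj.
Qed.

Lemma reflection_zexp_inj u v a b :
  zexp (reflection u) a = zexp (reflection v) b -> u <> v -> zeta u ^ a = 1.
Proof.
(* On a function supported at [u], powers of [reflection v] leave the coordinate [(u, false)]
   unchanged, whereas the power of [reflection u] scales it by [zeta u ^ a]. *)
move=> E uv; pose phi w (i : bool) : R := if `[< w = u >] then 1 else 0.
have := congr1 (fun f => bij_fun f phi u false) E.
rewrite !reflection_zexp preflection_self /preflection /phi asboolT //.
rewrite asboolF; last exact/nesym.
by rewrite !mulr0 !subr0 mulr1 => /polyC_inj.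
Qed.

Lemma reflection_order v n : qd_f Gamma v = Some n -> (reflection v ^+ n)%g = 1%g.
Proof.
move=> /zetaP/prim_expr_order zn; apply: bij_ext => phi.
by rewrite reflection_exp zn expr1n preflection1.
Qed.

Lemma reflection_comm u v : qd_adj Gamma u v -> qd_m Gamma u v = 2 ->
  commute (reflection u) (reflection v).
Proof.
move=> uv m2; apply: bij_ext => phi; rewrite !bij_mulE /=.
apply/funext => w; apply/funext => i.
have vu := qd_adj_sym uv; have m2' := m2; rewrite (qd_m_sym uv) in m2'.
rewrite /preflection !(form_comm _ _ uv m2) !(form_comm _ _ vu m2'); ring.
Qed.

Lemma braid_labels u v : qd_adj Gamma u v -> (2 < qd_m Gamma u v)%N ->
  exists p q, [/\ qd_f Gamma u = Some p, qd_f Gamma v = Some q, ~~ odd p,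
    ~~ odd q & p = 2 \/ q = 2].
Proof.
move=> uv m2; case: (boolP (odd (qd_m Gamma u v))) => mo.
  exact: qd_odd.
by have [-> ->] := qd_even uv m2 mo; exists 2, 2; split=> //; left.
Qed.

(** Its square is [1], and the value [1] is excluded by the order [p], since [0 < p./2 < p]. *)
Lemma zeta_half v p : qd_f Gamma v = Some p -> ~~ odd p ->
  zeta v ^+ p./2 = -1.
Proof.
move=> fv pe; have zp := zetaP fv; have p2 := qd_f_ge2 fv.
have pE : p = (p./2).*2 by rewrite -[LHS]odd_double_half (negbTE pe).
have : (zeta v ^+ p./2) ^+ 2 == 1.
  by rewrite -exprM muln2 -pE prim_expr_order.
rewrite sqrf_eq1 => /orP[/eqP zh|/eqP//].
have := prim_order_dvd zp p./2; rewrite zh eqxx.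
by move/(dvdn_leq _) => /(_ ltac:(lia)); lia.
Qed.

Lemma eta_neq0 M : (2 < M)%N -> eta M != 0.
Proof.
move=> m2.
by rewrite (prim_root_eq0 (etaP m2)); lia.
Qed.

Lemma eta_double M : (2 < M)%N -> eta M ^+ 2 != 1.
Proof.
move=> m2.
rewrite -(prim_order_dvd (etaP m2)); apply/negP => /(dvdn_leq (ltn0Sn 1)); lia.
Qed.

Lemma eta_half M : (2 < M)%N -> eta M ^+ M = -1.
Proof.
move=> m2.
have M0 : (0 < M)%N by exact: ltnW (ltnW m2).
have : (eta M ^+ M) ^+ 2 == 1 by rewrite -exprM muln2 prim_expr_order ?etaP.
rewrite sqrf_eq1 => /orP[|/eqP//].
by rewrite -(prim_order_dvd (etaP m2)) => /(dvdn_leq M0); lia.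
Qed.

Lemma two_neq0 M : (2 < M)%N -> 2%:R != 0 :> F.
Proof.
move=> m2.
have M0 : (0 < M)%N by exact: ltnW (ltnW m2).
apply/eqP => two0; have : eta M ^+ M = 1.
  by rewrite eta_half //; apply/eqP; rewrite eqr_oppLR -addr_eq0 -mulr2n two0.
move/eqP; rewrite -(prim_order_dvd (etaP m2)) => /(dvdn_leq M0); lia.
Qed.

(** * Products of two reflections along an edge of label greater than two *)

Section Braid.
Variables (u v : V) (p q : nat).
Hypotheses (uv : qd_adj Gamma u v) (m2 : (2 < qd_m Gamma u v)%N).
Hypotheses (fu : qd_f Gamma u = Some p) (fv : qd_f Gamma v = Some q).
Hypotheses (pe : ~~ odd p) (qe : ~~ odd q).
Local Notation M := (qd_m Gamma u v).
Local Notation s := (reflection u ^+ p./2)%g.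
Local Notation t := (reflection v ^+ q./2)%g.
Local Notation e := (eta M).

Lemma braid_reflection w f k : qd_f Gamma w = Some k -> ~~ odd k ->
  bij_fun (reflection w ^+ k./2)%g f = preflection w (-1) 1 f.
Proof.
by move=> fw ke; rewrite reflection_exp (zeta_half fw ke) sqrrN expr1n polyCN.
Qed.

Local Notation D := (2 * form u false v false).

Lemma form_uv_sym : form v false u false = form u false v false.
Proof.
have m2' := m2; rewrite (qd_m_sym uv) in m2'.
rewrite (form_braid _ _ (qd_adj_sym uv)) //.
by rewrite (form_braid _ _ uv) // (qd_m_sym uv).
Qed.

Lemma form_uvE : D = e%:P + e^-1%:P.
Proof.
rewrite form_braid //= -polyCD -[2]/(1 + 1) -polyC1 -polyCD -polyCM.
by rewrite mulrC divfK // (two_neq0 m2).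
Qed.

Lemma eta_polyV : e%:P * e^-1%:P = 1 :> R.
Proof. by rewrite -polyCM divff // (eta_neq0 m2). Qed.

Lemma braid_product_u phi : bij_fun (s * t)%g phi u false =
  D * phi v false - phi u false.
Proof.
rewrite bij_mulE (braid_reflection _ fu) // (braid_reflection _ fv) //.
rewrite /preflection !form_same.
rewrite ?form_uv_sym /=; ring.
Qed.

Lemma braid_product_v phi : bij_fun (s * t)%g phi v false =
  D ^+ 2 * phi v false - phi v false - D * phi u false.
Proof.
rewrite bij_mulE (braid_reflection _ fu) // (braid_reflection _ fv) //.
rewrite /preflection !form_same.
rewrite ?form_uv_sym /=; ring.
Qed.

(* On the plane of the coordinates [(u, false)] and [(v, false)] the product of
   the two reflections has the eigenvalues [e ^ 2] and [e ^- 2]. *)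
Lemma braid_eigen phi (z z' : R) : z * z' = 1 -> D = z + z' ->
  bij_fun (s * t)%g phi v false - z' * bij_fun (s * t)%g phi u false =
  z ^+ 2 * (phi v false - z' * phi u false).
Proof.
move=> zz' Dz; rewrite braid_product_u braid_product_v Dz.
transitivity (z ^+ 2 * (phi v false - z' * phi u false) +
  (z * z' - 1) * (phi v false + z * phi u false)); first by ring.
by rewrite zz' subrr mul0r addr0.
Qed.

Lemma braid_eigen_exp phi (z z' : R) n : z * z' = 1 -> D = z + z' ->
  bij_fun ((s * t) ^+ n)%g phi v false -
    z' * bij_fun ((s * t) ^+ n)%g phi u false =
  z ^+ (n.*2) * (phi v false - z' * phi u false).
Proof.
move=> zz' Dz; elim: n => [|n IHn]; first by rewrite /= mul1r.
rewrite expgS bij_mulE (braid_eigen _ zz' Dz) IHn mulrA -exprD.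
by rewrite doubleS.
Qed.

(** The matrix with rows [(2, D)] and [(D, 2)] is invertible, so any coordinate can be corrected by
    multiples of [(u, false)] and [(v, false)] into a functional fixed by both reflections. *)
Lemma braid_invariant w i : exists a b : R, forall phi,
  let z (f : V -> bool -> R) := f w i + a * f u false + b * f v false in
  z (bij_fun (s * t)%g phi) = z phi.
Proof.
have Dn : exists k, k * (4 - D ^+ 2) = 1.
  have e0 := eta_neq0 m2.
  have ee : e - e^-1 != 0.
    rewrite subr_eq0; apply: contra (eta_double m2) => /eqP ee.
    by rewrite expr2 {2}ee divff.
  (* Since [e * e^-1 = 1], the determinant [4 - D ^ 2] equals [- (e - e^-1) ^ 2], a nonzero
     constant. *)
  exists (- (e - e^-1) ^- 2)%:P; rewrite form_uvE.
  have -> : 4 - (e%:P + e^-1%:P) ^+ 2 = - (e%:P - e^-1%:P) ^+ 2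
    + 4 * (1 - e%:P * e^-1%:P) :> R by ring.
  rewrite eta_polyV subrr mulr0 addr0 -polyCB -polyC_exp -polyCN -polyCM.
  by rewrite mulrNN mulVf // expf_neq0.
have [k kD] := Dn.
set d := form w i u false; set d' := form w i v false.
(* Cramer's rule for the equations [Ea] and [Eb] below, which express invariance under [s] and under
   [t]. *)
pose a := k * (- 4 * d + 2 * D * d'); pose b := k * (- 4 * d' + 2 * D * d).
have Ea : - 2 * d - 2 * a - D * b = 0.
  transitivity (- 2 * d * (1 - k * (4 - D ^+ 2))); first by rewrite /a /b; ring.
  by rewrite kD subrr mulr0.
have Eb : - 2 * d' - D * a - 2 * b = 0.
  transitivity (- 2 * d' * (1 - k * (4 - D ^+ 2))); first by rewrite /a /b; ring.
  by rewrite kD subrr mulr0.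
exists a, b => phi z; rewrite /z bij_mulE.
rewrite (braid_reflection _ fu) // (braid_reflection _ fv) //.
set f := preflection v _ _ _; transitivity (z f).
  transitivity (z f + (- 2 * d - 2 * a - D * b) * f u false).
    by rewrite /z /preflection !form_same form_uv_sym -/d /=; ring.
  by rewrite Ea mul0r addr0.
transitivity (z phi + (- 2 * d' - D * a - 2 * b) * phi v false).
  by rewrite /z /f /preflection !form_same -/d' /=; ring.
by rewrite Eb mul0r addr0.
Qed.

(** The eigenvalues [e ^ 2] and [e ^- 2] have [M]-th power [1], and as [e] differs from its inverse
    the two eigenfunctionals recover both plane coordinates; [braid_invariant] settles the other
    coordinates. *)
Lemma braid_product_order : ((s * t) ^+ M = 1)%g.
Proof.
apply: bij_ext => phi; set f := bij_fun _ phi.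
have zz' := eta_polyV; have Dz := form_uvE.
have pow (z : F) : z ^+ M.*2 = 1 -> z%:P ^+ M.*2 = 1 :> R.
  by rewrite -polyC_exp => ->.
have eM := prim_expr_order (etaP m2).
have := @braid_eigen_exp phi _ _ M zz' Dz.
rewrite pow // mul1r /= -/f => E1.
rewrite mulrC in zz'; rewrite addrC in Dz.
have := @braid_eigen_exp phi _ _ M zz' Dz.
rewrite pow ?exprVn ?eM ?invr1 // mul1r /= -/f => E2.
have ee : e%:P - e^-1%:P != 0 :> R.
  rewrite -polyCB polyC_eq0 subr_eq0; apply: contra (eta_double m2) => /eqP ee.
  by rewrite expr2 {2}ee divff // (eta_neq0 m2).
have Eu : f u false = phi u false.
  apply: (mulfI ee).
  transitivity ((f v false - e^-1%:P * f u false) -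
                (f v false - e%:P * f u false)); first by ring.
  by rewrite E1 E2; ring.
have Ev : f v false = phi v false by move: E1; rewrite Eu => /addIr.
apply/funext => w; apply/funext => i.
have [a [b ab]] := braid_invariant w i.
have : f w i + a * f u false + b * f v false =
       phi w i + a * phi u false + b * phi v false.
  rewrite /f; elim: (M) => // n IHn.
  by rewrite expgS bij_mulE ab.
by rewrite Eu Ev => /addIr/addIr.
Qed.

Lemma braid_product_dvd m : ((s * t) ^+ m = 1)%g -> (M %| m)%N.
Proof.
(* On a function supported at [v] the eigenvalue equation reads [1 = e ^ (2 m)], and [e] has order
   [2 M]. *)
move=> st1; pose phi w (i : bool) : R := if `[< w = v >] then 1 else 0.
have := @braid_eigen_exp phi _ _ m eta_polyV form_uvE.
rewrite st1 /= /phi asboolT // asboolF; last exact: adj_neq.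
rewrite mulr0 subr0 mulr1 -polyC_exp => /esym/polyC_inj/eqP.
by rewrite -(prim_order_dvd (etaP m2)) -!muln2 dvdn_pmul2r.
Qed.

Lemma braid_involution w k : qd_f Gamma w = Some k -> ~~ odd k ->
  (reflection w ^+ k./2 * reflection w ^+ k./2 = 1)%g.
Proof.
move=> fw ke; rewrite -expgnDr addnn.
have -> : k./2.*2 = k by rewrite -[RHS]odd_double_half (negbTE ke).
exact: reflection_order.
Qed.

Lemma reflection_braid : weval (alternating s t M) = weval (alternating t s M).
Proof.
apply/(alternating_involutions _ (braid_involution fu pe)
  (braid_involution fv qe)); exact: braid_product_order.
Qed.
End Braid.

Lemma reflection_relations : qd_relations Gamma reflection.
Proof.
split; [exact: reflection_order|exact: reflection_comm|].
move=> u v p q uv m2 fu fv.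
have [p' [q' [fu' fv' pe qe _]]] := braid_labels uv m2.
move: fu' fv' pe qe; rewrite fu fv => -[<-] [<-] pe qe.
exact: reflection_braid.
Qed.

(** The term with ['X * g] has larger degree than [f], so its leading coefficient survives; this
    growth drives both ping-pong arguments. *)
Lemma size_shear (f g : R) (c : F) : g != 0 -> c != 0 ->
  (size f <= size g)%N -> size (f - c%:P * 'X * g) = (size g).+1.
Proof.
move=> g0 c0 fg; rewrite addrC -mulrA mul_polyC -commr_polyX.
have Eg : size (- (c *: (g * 'X))) = (size g).+1.
  by rewrite size_polyN size_scale // size_mulX.
by rewrite size_polyDl Eg.
Qed.

(** The coordinates at [false] of non-adjacent vertices are coupled by ['X]: each syllable makes the
    degree at the other vertex strictly larger than at its own, and the next syllable reverses the
    inequality. *)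
Lemma free_alternating u v a b m : u <> v -> ~ qd_adj Gamma u v ->
  zeta u ^ a != 1 -> zeta v ^ b != 1 -> (0 < m)%N ->
  weval (alternating (zexp (reflection u) a) (zexp (reflection v) b) m) <>
  weval (alternating (zexp (reflection v) b) (zexp (reflection u) a) m).
Proof.
move=> uv nuv.
have step w z k (phi : V -> bool -> R) : w <> z -> ~ qd_adj Gamma w z ->
    zeta w ^ k != 1 ->
    (size (phi z false) <= size (phi w false))%N -> phi w false != 0 ->
    let f := bij_fun (zexp (reflection w) k) phi in
    (size (f w false) < size (f z false))%N.
  move=> wz nwz wk zw0 w0 /=.
  have nzw : ~ qd_adj Gamma z w by move=> zw; apply: nwz; exact: qd_adj_sym.
  have zw' := nesym wz.
  rewrite reflection_zexp preflection_self /preflection !form_free //=.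
  rewrite mulr0 mul0r subr0 -polyC1 -polyCB size_shear //.
    by rewrite mul_polyC (leq_ltn_trans (size_scale_leq _ _)).
  by rewrite subr_eq0 eq_sym.
move=> ua vb.
have nvu : ~ qd_adj Gamma v u by move=> vu; apply: nuv; exact: qd_adj_sym.
have vu := nesym uv.
have pos (g h : R) : (size g < size h)%N -> h != 0.
  by rewrite -size_poly_gt0; apply: leq_ltn_trans.
(* The constant function has coordinates of equal degree, which suffices for a first move by either
   syllable. *)
apply: (@ping_pong _ _ _
  (fun phi : V -> bool -> R => size (phi u false) < size (phi v false))%N
  (fun phi : V -> bool -> R => size (phi v false) < size (phi u false))%N
  (fun _ _ => 1 : R)).
- by apply: step => //=; rewrite oner_eq0.
- by apply: step => //=; rewrite oner_eq0.
- by move=> phi lt; apply: step => //; [exact: ltnW|exact: pos lt].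
- by move=> phi lt; apply: step => //; [exact: ltnW|exact: pos lt].
- by move=> phi ? ?; lia.
Qed.

(** By the hypothesis on [a] the power of [reflection u] shears along [(u, true)], while that of
    [reflection v] is a reflection along [(v, false)] alone. These two coordinates are coupled by
    ['X] and play ping-pong. *)
Lemma braid_alternating u v a b m : qd_adj Gamma u v ->
  (2 < qd_m Gamma u v)%N -> (zeta u ^ a) ^+ 2 != 1 ->
  zeta v ^ b = -1 -> (0 < m)%N ->
  weval (alternating (zexp (reflection u) a) (zexp (reflection v) b) m) <>
  weval (alternating (zexp (reflection v) b) (zexp (reflection u) a) m).
Proof.
move=> uv m2 ua vb.
have vu := qd_adj_sym uv.
have m2' : (2 < qd_m Gamma v u)%N by rewrite -(qd_m_sym uv).
have two0 := two_neq0 m2.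
(* The coordinate [(u, false)] is coupled to [(v, false)] by a constant, so its degree is tracked
   too and kept from exceeding the leading one. *)
have step (phi : V -> bool -> R) : (size (phi v false) <= size (phi u true))%N ->
    (size (phi u false) <= size (phi u true))%N -> phi u true != 0 ->
    let f := bij_fun (zexp (reflection u) a) phi in
    (size (f u true) < size (f v false))%N /\
    (size (f u false) < size (f v false))%N.
  move=> pv pu p0 /=.
  rewrite reflection_zexp !preflection_self /preflection !form_braid //=.
  rewrite -polyC1 -!polyCB size_shear //.
  + by rewrite !mul_polyC !ltnS !(leq_trans (size_scale_leq _ _)).
  + by rewrite subr_eq0 eq_sym.
  + rewrite (leq_trans (size_polyD _ _)) // geq_max pv size_polyN.
    by rewrite -polyCM mul_polyC (leq_trans (size_scale_leq _ _)).
have step' (phi : V -> bool -> R) : (size (phi u true) <= size (phi v false))%N ->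
    (size (phi u false) <= size (phi v false))%N -> phi v false != 0 ->
    let f := bij_fun (zexp (reflection v) b) phi in
    (size (f v false) < size (f u true))%N /\
    (size (f u false) < size (f u true))%N.
  move=> p1 p0 pv /=.
  rewrite reflection_zexp !preflection_self /preflection !form_braid //= vb.
  rewrite -polyC1 -!polyCB sqrrN expr1n subrr polyC0 !mul0r !subr0 opprK.
  have -> := size_shear pv two0 p1; rewrite !ltnS; split.
    by rewrite mul_polyC (leq_trans (size_scale_leq _ _)).
  rewrite (leq_trans (size_polyD _ _)) // geq_max p0 size_polyN.
  by rewrite -polyCM mul_polyC (leq_trans (size_scale_leq _ _)).
have pos (g h : R) : (size g < size h)%N -> h != 0.
  by rewrite -size_poly_gt0; apply: leq_ltn_trans.
apply: (@ping_pong _ _ _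
  (fun phi : V -> bool -> R =>
    size (phi u true) < size (phi v false) /\
    size (phi u false) < size (phi v false))%N
  (fun phi : V -> bool -> R =>
    size (phi v false) < size (phi u true) /\
    size (phi u false) < size (phi u true))%N
  (fun _ _ => 1 : R)).
- by apply: step => //=; rewrite oner_eq0.
- by apply: step' => //=; rewrite oner_eq0.
- by move=> phi [v1 u1]; apply: step; [exact: ltnW|exact: ltnW|exact: pos v1].
- by move=> phi [v1 u1]; apply: step'; [exact: ltnW|exact: ltnW|exact: pos v1].
- by move=> phi [? ?] [? ?]; lia.
Qed.
End Representation.

(** * Powers and alternating products of the generators *)

Section Generators.
Variables (V : Type) (Gamma : qd_graph V).
Local Notation x := (qd_gen Gamma).

Lemma exists_roots : exists (zeta : V -> algC) (eta : nat -> algC),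
  [/\ forall v n, qd_f Gamma v = Some n -> (n.-primitive_root (zeta v))%R,
      forall v n, qd_f Gamma v = None -> (0 < n)%N ->
        (zeta v ^+ n != 1)%R,
      forall v, (zeta v != 0)%R
    & forall M, (2 < M)%N -> (M.*2.-primitive_root (eta M))%R].
Proof.
have /choice[zeta zetaP] v : exists z : algC,
    if qd_f Gamma v is Some n then (n.-primitive_root z)%R else (z == 2)%R.
  case fv: (qd_f _ _) => [n|]; last by exists 2%R.
  have [|z zP] := @C_prim_root_exists n; last by exists z.
  exact: ltnW (qd_f_ge2 fv).
have /choice[eta etaP] M : exists z : algC,
    (2 < M)%N -> (M.*2.-primitive_root z)%R.
  case: (ltnP 2 M) => [M2|]; last by exists 0%R.
  by have [|z zP] := @C_prim_root_exists M.*2; [lia|exists z].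
exists zeta, eta; split=> // [v n fv|v n fv n0|v].
- by have := zetaP v; rewrite fv.
- have := zetaP v; rewrite fv => /eqP->.
  by rewrite gt_eqF // exprn_egt1 ?ltr1n // -lt0n.
- have := zetaP v; case fv: (qd_f _ _) => [n|] => [zP|/eqP->].
    by rewrite (prim_root_eq0 zP); case: n fv zP => // /qd_f_ge2.
  by rewrite pnatr_eq0.
Qed.

Lemma zexp_qd (H : groupType) (y : V -> H) v a : qd_relations Gamma y ->
  (if qd_f Gamma v is Some n then (n%:Z %| a)%Z else a == 0%R) ->
  zexp (y v) a = 1.
Proof.
move=> [yf _ _]; case fv: (qd_f _ _) => [n|]; last by move/eqP->.
exact/zexp_dvd/yf.
Qed.

Lemma qd_gen_zexp_eq1 v a : zexp (x v) a = 1 ->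
  if qd_f Gamma v is Some n then (n%:Z %| a)%Z else a == 0%R.
Proof.
have [zeta [eta [zP zinf z0 eP]]] := exists_roots.
have [f fM fx] := qd_hom (reflection_relations zP z0 eP) => xa.
apply: (zeta_expz_eq1 zP zinf); apply: (@reflection_zexp_eq1 _ Gamma _ _ eta z0).
by rewrite -fx -morph_zexp // xa morph_1.
Qed.

Lemma qd_gen_zexp_inj u v a b :
  zexp (x u) a = zexp (x v) b -> zexp (x u) a <> 1 -> u = v.
Proof.
have [zeta [eta [zP zinf z0 eP]]] := exists_roots.
have [f fM fx] := qd_hom (reflection_relations zP z0 eP) => E neq.
have [//|uv] := pselect (u = v); case: neq.
apply: (zexp_qd (qd_gen_relations Gamma)); apply: (zeta_expz_eq1 zP zinf).
apply: (@reflection_zexp_inj _ Gamma _ _ eta z0 u v a b) => //.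
by rewrite -!fx -!morph_zexp // E.
Qed.

(** Non-adjacent vertices are excluded by [free_alternating]. If the label exceeds two, one vertex
    has order two, so its syllable acts with factor [-1], and [braid_alternating] forces [-1] for
    the other one. Both syllables are then half powers, and [braid_product_dvd] gives the
    divisibility. *)
Lemma qd_gen_alternating u v a b m : u <> v ->
  zexp (x u) a <> 1 -> zexp (x v) b <> 1 -> (0 < m)%N ->
  weval (alternating (zexp (x u) a) (zexp (x v) b) m) =
  weval (alternating (zexp (x v) b) (zexp (x u) a) m) ->
  qd_adj Gamma u v /\
  (qd_m Gamma u v = 2 \/
   (2 < qd_m Gamma u v)%N /\ exists p q,
     [/\ qd_f Gamma u = Some p, qd_f Gamma v = Some q,
         ~~ odd p /\ ~~ odd q,
         zexp (x u) a = x u ^+ p./2 /\ zexp (x v) b = x v ^+ q./2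
       & qd_m Gamma u v %| m]).
Proof.
have [zeta [eta [zP zinf z0 eP]]] := exists_roots.
have [f fM fx] := qd_hom (reflection_relations zP z0 eP).
move=> uv sa tb m0 E.
have z1 w c : zexp (x w) c <> 1 -> (zeta w ^ c != 1)%R.
  move=> neq; apply/eqP => /(zeta_expz_eq1 zP zinf) wc; apply: neq.
  exact: zexp_qd (qd_gen_relations Gamma) wc.
have half w c k : qd_f Gamma w = Some k -> ~~ odd k -> (zeta w ^ c = -1)%R ->
    zexp (x w) c = x w ^+ k./2.
  move=> fw ke wc; apply/divg1_eq; rewrite -zexp_nat -zexpB.
  apply: (zexp_qd (qd_gen_relations Gamma)); apply: (zeta_expz_eq1 zP zinf).
  rewrite expfzDr // wc -exprnN (zeta_half zP fw ke) invrN1 mulrNN mulr1 //.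
pose r := reflection Gamma eta z0.
have {}E : weval (alternating (zexp (r u) a) (zexp (r v) b) m) =
           weval (alternating (zexp (r v) b) (zexp (r u) a) m).
  move/(congr1 f): E.
  by rewrite !(morph_weval fM) !map_alternating !(morph_zexp fM) !fx.
have adj : qd_adj Gamma u v.
  have [//|nuv] := pselect (qd_adj Gamma u v).
  by case: (free_alternating uv nuv (z1 _ _ sa) (z1 _ _ tb) m0 E).
split=> //; have [m2|m2] := leqP (qd_m Gamma u v) 2.
  by left; apply/eqP; rewrite eqn_leq m2 qd_m_ge2.
right; split=> //.
have [p [q [fu fv pe qe pq]]] := braid_labels adj m2; exists p, q.
have two w c : qd_f Gamma w = Some 2 -> ((zeta w ^ c) ^+ 2 = 1)%R.
  move=> /zP/prim_expr_order w2.
  by rewrite expr2 -expfzMl -expr2 w2 exp1rz.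
have neg w c : zexp (x w) c <> 1 -> ((zeta w ^ c) ^+ 2 = 1)%R ->
    (zeta w ^ c = -1)%R.
  by move=> /z1/negPf w1 /eqP; rewrite sqrf_eq1 w1 => /eqP.
have [ua vb] : (zeta u ^ a = -1)%R /\ (zeta v ^ b = -1)%R.
  (* The vertex of order two takes the role of [v] in [braid_alternating]; if it is [u], the edge is
     reversed. *)
  case: pq => k2; [rewrite k2 in fu|rewrite k2 in fv].
    have ua := neg _ _ sa (two _ a fu); split=> //; apply: (neg _ _ tb).
    apply/eqP/negPn/negP => vb; have m2' := m2; rewrite (qd_m_sym adj) in m2'.
    exact: (braid_alternating eP (qd_adj_sym adj) m2' vb ua m0 (esym E)).
  have vb := neg _ _ tb (two _ b fv); split=> //; apply: (neg _ _ sa).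
  by apply/eqP/negPn/negP => ua; exact: (braid_alternating eP adj m2 ua vb m0 E).
have sE := half _ _ _ fu pe ua; have tE := half _ _ _ fv qe vb.
split=> //; apply: (braid_product_dvd zP (zeta_neq0 := z0) eP adj m2 fu fv pe qe).
have rE w c k : zexp (x w) c = x w ^+ k -> zexp (r w) c = r w ^+ k.
  by move/(congr1 f); rewrite morph_zexp // morph_X // fx.
rewrite (rE _ _ _ sE) (rE _ _ _ tE) in E.
apply/(alternating_involutions _ (braid_involution eta zP z0 fu pe)
  (braid_involution eta zP z0 fv qe)); exact: E.
Qed.
End Generators.

(** * Relations that persist in the restricted graph *)

Section Restriction.
Variables (V : Type) (Gamma : qd_graph V) (U : set V).
Variables (H : groupType) (y : U -> H).
Hypothesis yR : qd_relations (qd_restrict Gamma U) y.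
Local Notation x := (qd_gen Gamma).

(** Powers of [x (val u)] coincide only when the order relation at this vertex forces it, and [y]
    satisfies the same relation. *)
Lemma zexp_restrict (u : U) a b :
  zexp (x (val u)) a = zexp (x (val u)) b -> zexp (y u) a = zexp (y u) b.
Proof.
move=> E; apply/divg1_eq; rewrite -zexpB; apply: (zexp_qd yR).
by apply: (@qd_gen_zexp_eq1 _ Gamma (val u)); rewrite zexpB E mulgV.
Qed.

(** By [qd_gen_alternating] the equality is due to an edge between the two vertices, which also
    belongs to the full subgraph on [U]. *)
Lemma alternating_restrict (u v : U) a b m : val u <> val v ->
  zexp (x (val u)) a <> 1 -> zexp (x (val v)) b <> 1 -> (0 < m)%N ->
  weval (alternating (zexp (x (val u)) a) (zexp (x (val v)) b) m) =
  weval (alternating (zexp (x (val v)) b) (zexp (x (val u)) a) m) ->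
  weval (alternating (zexp (y u) a) (zexp (y v) b) m) =
  weval (alternating (zexp (y v) b) (zexp (y u) a) m).
Proof.
move=> uv sa tb m0 E.
have [adj [m2|[m2 [p [q [fu fv [pe qe] [sE tE] /dvdnP[k mE]]]]]]] :=
  qd_gen_alternating uv sa tb m0 E.
  have [_ comm _] := qd_gen_relations Gamma.
  have st : commute (zexp (x (val u)) a) (zexp (x (val v)) b).
    by apply: commute_zexp; exact: comm.
  (* Distinct commuting syllables satisfy the relation only for even [m], and for even [m]
     commutation is enough. *)
  apply: even_alternating_commute.
    by apply: commute_zexp; case: yR => _ + _; apply.
  by apply: commute_alternating st _ E => st1; exact/uv/(qd_gen_zexp_inj st1).
have -> : zexp (y u) a = y u ^+ p./2 by exact: (@zexp_restrict u a p./2).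
have -> : zexp (y v) b = y v ^+ q./2 by exact: (@zexp_restrict v b q./2).
case: yR => yf _ yb.
have inv (w : U) n : qd_f Gamma (val w) = Some n -> ~~ odd n ->
    y w ^+ n./2 * y w ^+ n./2 = 1.
  move=> fw ne; rewrite -expgnDr addnn.
  have -> : n./2.*2 = n by rewrite -[RHS]odd_double_half (negbTE ne).
  exact: yf.
have := yb _ _ _ _ adj m2 fu fv.
move/(alternating_involutions _ (inv _ _ fu pe) (inv _ _ fv qe)) => /= stM.
apply/(alternating_involutions _ (inv _ _ fu pe) (inv _ _ fv qe)).
by rewrite mE mulnC expgnA stM expg1n.
Qed.
End Restriction.

(** * Syllabic words and M-operations *)

Section Words.
Variables (G : groupType) (A : set G).

(** By [zexp_eq1] the condition on the exponent says that the power is nontrivial; in this form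
    syllables pass between a group and its subgroup without comparing orders. *)
Lemma syllableE s :
  syllable A s <-> exists g a, [/\ A g, s = zexp g a & s <> 1].
Proof.
split=> [[g [a [Ag na sE]]]|[g [a [Ag sE s1]]]]; exists g, a; split=> //.
  by rewrite sE => /zexp_eq1 ga; rewrite ga in na.
by apply/negP => /zexp_eq1; rewrite -sE.
Qed.

Lemma gen1 : gen A 1.
Proof. exact: set_mem (gen_closed A).1. Qed.

Lemma genF g h : gen A g -> gen A h -> gen A (g / h).
Proof.
by move=> Ag Ah; apply: set_mem; apply: (gen_closed A).2; apply: mem_set.
Qed.

Lemma genV g : gen A g -> gen A g^-1.
Proof. by rewrite -div1g; apply: genF; exact: gen1. Qed.

Lemma genM g h : gen A g -> gen A h -> gen A (g * h).
Proof. by move=> Ag Ah; rewrite -[h]invgK; apply: genF => //; apply: genV. Qed.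

Lemma gen_zexp g a : gen A g -> gen A (zexp g a).
Proof.
move=> Ag; have nat n : gen A (g ^+ n).
  elim: n => [|n IHn]; first exact: gen1.
  by rewrite expgS; exact: genM.
by case: a => n; [exact: nat|exact: genV].
Qed.

Lemma gen_smallest (P : set G) : P 1 ->
  (forall g h, P g -> P h -> P (g / h)) -> A `<=` P -> gen A `<=` P.
Proof.
move=> P1 PF AP; apply: smallest_sub => //; split; first exact/mem_set.
by move=> g h /set_mem Pg /set_mem Ph; apply/mem_set; exact: PF.
Qed.

Lemma syllable_gen s : syllable A s -> gen A s.
Proof. by case/syllableE => g [a [Ag -> _]]; exact: gen_zexp (sub_gen _). Qed.

Lemma syllabic_cat w w' :
  syllabic A (w ++ w') <-> syllabic A w /\ syllabic A w'.
Proof.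
split=> [ww'|[Aw Aw'] s]; last by rewrite mem_cat => /orP[/Aw|/Aw'].
by split=> s sw; apply: ww'; rewrite mem_cat sw ?orbT.
Qed.

Lemma syllabic_cons s w : syllabic A (s :: w) <-> syllable A s /\ syllabic A w.
Proof.
split=> [sw|[As Aw] r]; last by rewrite inE => /orP[/eqP->|/Aw].
by split=> [|r rw]; apply: sw; rewrite inE ?eqxx ?rw ?orbT.
Qed.

Lemma syllabic_alternating s t m :
  syllable A s -> syllable A t -> syllabic A (alternating s t m).
Proof. by move=> As At r /mem_alternating[]->. Qed.

Lemma gen_word g : gen A g -> exists2 w, syllabic A w & weval w = g.
Proof.
move: g; apply: gen_smallest => [|g h [w Aw <-] [w' Aw' <-]|g Ag].
- by exists [::]; [|exact: weval_nil].
- exists (w ++ rev [seq r^-1 | r <- w']).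
    apply/syllabic_cat; split=> // s; rewrite mem_rev => /mapP[r /Aw'].
    move=> /syllableE[k [a [Ak -> ka]]] ->; apply/syllableE.
    exists k, (- a)%R; split=> //; first by rewrite zexpN.
    by move/eqP; rewrite invg_eq1 => /eqP.
  rewrite weval_cat; congr (_ * _).
  elim: w' {Aw'} => [|r w' IHw'] /=; first by rewrite !weval_nil invg1.
  rewrite rev_cons -cats1 weval_cat IHw' !weval_cons weval_nil mulg1.
  by rewrite invgM.
have [->|g1] := pselect (g = 1); first by exists [::]; [|exact: weval_nil].
exists [:: g]; last by rewrite weval_cons weval_nil mulg1.
by move=> s; rewrite inE => /eqP->; apply/syllableE; exists g, 1%R.
Qed.

Lemma slength_le w : syllabic A w -> (slength A (weval w) <= size w)%N.
Proof.
move=> Aw; rewrite /slength; case: pselect => [h|//].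
by case: ex_minnP => n _; apply; apply/asboolP; exists w.
Qed.

Lemma slength_attained g : gen A g ->
  exists w, [/\ syllabic A w, weval w = g & size w = slength A g].
Proof.
move=> /gen_word[w Aw wg]; rewrite /slength; case: pselect => [h|[]].
  by case: ex_minnP => n /asboolP[w' [? ? ?]] _; exists w'.
by exists (size w); apply/asboolP; exists w.
Qed.

Lemma Mop1_weval w w' : Mop1 A w w' -> weval w = weval w'.
Proof.
case=> {w w'} w1 w2 s t _ _ => [_ _|st]; rewrite !weval_cat !weval_cons.
  by rewrite weval_nil !mulg1.
by rewrite weval_nil mulg1 st mul1g.
Qed.

Lemma Mop2_weval w w' : Mop2 A w w' -> weval w = weval w'.
Proof. by case=> {w w'} w1 w2 s t m _ _ _ st _; rewrite !weval_cat st. Qed.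

Lemma Mop_weval w w' : Mop A w w' -> weval w = weval w'.
Proof. by case=> [/Mop1_weval|/Mop2_weval]. Qed.
End Words.

Lemma clos_refl_trans_map (T T' : Type) (R : T -> T -> Prop)
    (R' : T' -> T' -> Prop) (P : T -> Prop) (f : T -> T') w w' :
  (forall v v', P v -> R v v' -> P v' /\ R' (f v) (f v')) ->
  P w -> clos_refl_trans _ R w w' ->
  P w' /\ clos_refl_trans _ R' (f w) (f w').
Proof.
move=> step Pw /clos_rt_rtn1_iff; elim=> [|v v' vv' _ [Pv wv]].
  by split=> //; exact: rt_refl.
have [Pv' fvv'] := step _ _ Pv vv'; split=> //.
by apply: rt_trans wv _; exact: rt_step.
Qed.

(** * Lengths and M-operations in the subgroup generated by [Y] *)

Section Parabolic.
Variables (G : groupType) (X Y : set G).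
Hypotheses (hX : strongly_marked X) (hD : property_D X) (YX : Y `<=` X).
Local Notation Y' := (gen_set Y).

Lemma syllable_sub s : syllable Y s -> syllable X s.
Proof. by case/syllableE=> g [a [/YX Xg ? ?]]; apply/syllableE; exists g, a. Qed.

Lemma syllabic_sub w : syllabic Y w -> syllabic X w.
Proof. by move=> Yw s /Yw/syllable_sub. Qed.

(** Strong marking forces both factors to be powers of one generator, which lies in [Y]. *)
Lemma syllable_mul s t : syllable Y s -> syllable Y t ->
  syllable X (s * t) -> syllable Y (s * t).
Proof.
move=> /syllableE[g [a [Yg sE s1]]] /syllableE[h [b [Yh tE t1]]] st.
have [_ _ strong] := hX; have gh : g = h.
  apply: (strong g h s t) => //; [exact: YX|exact: YX| | |by left].
    by rewrite sE; exact: gen_zexp (sub_gen _).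
  by rewrite tE; exact: gen_zexp (sub_gen _).
apply/syllableE; exists g, (a + b)%R.
by rewrite zexpD -sE {2}gh -tE; case/syllableE: st => ? [? []].
Qed.

Lemma Mop1_syllabic w w' : Mop1 X w w' -> syllabic Y w -> syllabic Y w'.
Proof.
case=> {w w'} w1 w2 s t Xs Xt => [Xst _|_] /syllabic_cat[Yw1].
  move=> /syllabic_cons[Ys] /syllabic_cons[Yt Yw2].
  apply/syllabic_cat; split=> //; apply/syllabic_cons; split=> //.
  exact: syllable_mul.
move=> /syllabic_cons[_] /syllabic_cons[_ Yw2].
by apply/syllabic_cat.
Qed.

Lemma syllabic_alternating_inv s t m : (2 <= m)%N ->
  syllabic Y (alternating s t m) -> syllable Y s /\ syllable Y t.
Proof.
by case: m => [|[|m]] // _ /syllabic_cons[Ys] /syllabic_cons[Yt _].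
Qed.

Lemma Mop2_syllabic w w' : Mop2 X w w' -> syllabic Y w -> syllabic Y w'.
Proof.
case=> {w w'} w1 w2 s t m _ _ m2 _ _ /syllabic_cat[Yw1].
move=> /syllabic_cat[/(syllabic_alternating_inv m2)[Ys Yt] Yw2].
apply/syllabic_cat; split=> //; apply/syllabic_cat; split=> //.
exact: syllabic_alternating.
Qed.

Lemma Mop_syllabic w w' : Mop X w w' -> syllabic Y w -> syllabic Y w'.
Proof. by case=> [/Mop1_syllabic|/Mop2_syllabic]. Qed.

Lemma Mop_closure_syllabic w w' : clos_refl_trans _ (Mop X) w w' ->
  syllabic Y w -> syllabic Y w' /\ weval w = weval w'.
Proof.
elim=> {w w'} [w w' ww' Yw|//|w w' w'' _ IH _ IH' /IH[/IH'[Yw'' <-] ->]//].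
by split; [exact: Mop_syllabic Yw|exact: Mop_weval ww'].
Qed.

(** By Property D in [G] a word that is not reduced can be shortened by M-operations; they keep it
    over [Y], and induction on the length applies. *)
Lemma reduce_word w : syllabic Y w ->
  exists w', [/\ clos_refl_trans _ (Mop X) w w', syllabic Y w' & reduced X w'].
Proof.
elim: {w}(size w) {-2}w (leqnn (size w)) => [|n IHn] w sw Yw.
  exists w; split=> //; first exact: rt_refl.
  by have := slength_le (syllabic_sub Yw); rewrite /reduced; lia.
have [red|nred] := pselect (reduced X w).
  by exists w; split=> //; exact: rt_refl.
have [w1 ww1 lt] : exists2 w', clos_refl_trans _ (Mop X) w w' &
    (size w' < size w)%N.
  apply: contrapT => Mred; apply: nred; apply/hD.1; first exact: syllabic_sub.
  by [].
have [Yw1 _] := Mop_closure_syllabic ww1 Yw.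
have [|w2 [w12 Yw2 red]] := IHn w1 _ Yw1; first by lia.
by exists w2; split=> //; exact: rt_trans w12.
Qed.

Lemma Mop_trivial w : syllabic Y w -> weval w = 1 ->
  clos_refl_trans _ (Mop X) w [::].
Proof.
move=> Yw w1; have [w' [ww' Yw' red]] := reduce_word Yw.
have [_ E] := Mop_closure_syllabic ww' Yw.
have nilX : syllabic X [::] by [].
have := slength_le nilX; rewrite weval_nil -w1 E -red leqn0 => /nilP w'0.
by rewrite w'0 in ww'.
Qed.

(** The inverse of [val] on [gen Y]; the value [1] elsewhere is a default. *)
Definition to_gen (g : G) : gen_group Y := insubd (1 : gen_group Y) g.

Lemma to_genK g : gen Y g -> val (to_gen g) = g.
Proof. by move=> Yg; rewrite val_insubd mem_set. Qed.

Lemma valK_gen : cancel val to_gen.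
Proof. by move=> g; exact: valKd. Qed.

Lemma gen_valM : {morph (val : gen_group Y -> G) : g h / g * h}.
Proof. by move=> g h; rewrite valM. Qed.

Lemma syllable_val s : syllable Y' s <-> syllable Y (val s).
Proof.
split=> /syllableE[g [a [Yg sE s1]]]; apply/syllableE.
  exists (val g), a; split=> //; first by rewrite sE (morph_zexp gen_valM).
  by rewrite -(morph_1 gen_valM) => /val_inj.
have gY := sub_gen Yg; exists (to_gen g), a; split.
- by rewrite /gen_set /= to_genK.
- by apply: val_inj; rewrite (morph_zexp gen_valM) to_genK.
- by move=> E; apply: s1; rewrite E (morph_1 gen_valM).
Qed.

Lemma syllabic_val w : syllabic Y' w <-> syllabic Y (map val w).
Proof.
split=> Yw s; first by case/mapP=> r /Yw/syllable_val Yr ->.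
by move=> sw; apply/syllable_val/Yw/map_f.
Qed.

Lemma map_to_genK w : syllabic Y w -> map val (map to_gen w) = w.
Proof.
move=> Yw; rewrite -map_comp -[RHS]map_id; apply/eq_in_map => s /Yw Ys /=.
by apply: to_genK; apply: syllable_gen.
Qed.

Lemma syllabic_to_gen w : syllabic Y w -> syllabic Y' (map to_gen w).
Proof. by move=> Yw; apply/syllabic_val; rewrite map_to_genK. Qed.

Lemma syllable_to_gen s : syllable Y s -> syllable Y' (to_gen s).
Proof.
by move=> Ys; apply/syllable_val; rewrite to_genK //; exact: syllable_gen.
Qed.

Lemma to_genM s t : gen Y s -> gen Y t -> to_gen (s * t) = to_gen s * to_gen t.
Proof.
move=> Ys Yt; apply: val_inj; rewrite gen_valM !to_genK //; exact: genM.
Qed.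

Lemma gen_gen_set (g : gen_group Y) : gen Y' g.
Proof.
suff /(_ _ (set_mem (valP g)))[h /val_inj-> //] :
  gen Y `<=` [set h | exists2 k : gen_group Y, val k = h & gen Y' k].
apply: gen_smallest => [|_ _ [h <- Yh] [k <- Yk]|h Yh].
- by exists 1; [exact: (morph_1 gen_valM)|exact: gen1].
- exists (h / k); last exact: genF.
  by rewrite gen_valM (morph_V gen_valM).
- have gY := sub_gen Yh; exists (to_gen h); first exact: to_genK.
  by apply: sub_gen; rewrite /gen_set /= to_genK.
Qed.

(** Words over [Y] are words over [X], which gives one inequality. Conversely, reducing a word over
    [Y] inside [G] ends in a word over [Y] of length [slength X (val g)]. *)
Lemma slength_val g : slength Y' g = slength X (val g).
Proof.
apply/eqP; rewrite eqn_leq; apply/andP; split.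
  have [w Yw wg] := gen_word (set_mem (valP g)).
  have [w' [ww' Yw' red]] := reduce_word Yw.
  have [_ E] := Mop_closure_syllabic ww' Yw.
  have -> : g = weval (map to_gen w').
    by apply: val_inj; rewrite (morph_weval gen_valM) map_to_genK // -E wg.
  rewrite (morph_weval gen_valM) map_to_genK // -red -(size_map to_gen).
  exact/slength_le/syllabic_to_gen.
have [w [Yw <- <-]] := slength_attained (gen_gen_set g).
rewrite (morph_weval gen_valM) -(size_map val).
exact/slength_le/syllabic_sub/syllabic_val.
Qed.
Lemma Mop1_to_gen w w' : syllabic Y w -> Mop1 X w w' ->
  Mop1 Y' (map to_gen w) (map to_gen w').
Proof.
move=> + ww'; case: ww' => {w w'} w1 w2 s t Xs Xt => [Xst st1|st1];
  move=> /syllabic_cat[Yw1] /syllabic_cons[Ys] /syllabic_cons[Yt Yw2];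
  have stM := to_genM (syllable_gen Ys) (syllable_gen Yt).
  rewrite !map_cat /= stM; apply: Mop1_merge; try exact: syllable_to_gen.
    by rewrite -stM; apply/syllable_to_gen/syllable_mul.
  rewrite -stM => /(congr1 val); rewrite to_genK; last first.
    by apply: genM; exact: syllable_gen.
  by rewrite (morph_1 gen_valM).
rewrite !map_cat; apply: Mop1_cancel; try exact: syllable_to_gen.
by rewrite -stM st1 -(morph_1 gen_valM) valK_gen.
Qed.

Lemma Mop2_to_gen w w' : syllabic Y w -> Mop2 X w w' ->
  Mop2 Y' (map to_gen w) (map to_gen w').
Proof.
move=> + ww'; case: ww' => {w w'} w1 w2 s t m Xs Xt m2 st lst.
move=> /syllabic_cat[Yw1] /syllabic_cat[/(syllabic_alternating_inv m2)[Ys Yt] _].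
have E r r' : syllable Y r -> syllable Y r' ->
    val (weval (alternating (to_gen r) (to_gen r') m)) =
    weval (alternating r r' m).
  move=> Yr Yr'; rewrite (morph_weval gen_valM) map_alternating !to_genK //;
  exact: syllable_gen.
rewrite !map_cat !map_alternating; apply: Mop2_swap => //.
- exact: syllable_to_gen.
- exact: syllable_to_gen.
- by apply: val_inj; rewrite !E.
(* The length condition of a type II operation survives because the two syllabic lengths agree. *)
- by rewrite slength_val E.
Qed.

Lemma Mop_val w w' : Mop Y' w w' -> Mop X (map val w) (map val w').
Proof.
have sylX s : syllable Y' s -> syllable X (val s).
  by move/syllable_val/syllable_sub.
case=> [] ww'; [left; case: ww'|right; case: ww'] => {w w'} w1 w2 s t.
- move=> Ys Yt Yst st1; rewrite !map_cat.
  have -> : map val [:: s * t] = [:: val s * val t] by rewrite -gen_valM.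
  apply: Mop1_merge; rewrite -?gen_valM; try exact: sylX.
  by rewrite -(morph_1 gen_valM) => /val_inj.
- move=> Ys Yt st1; rewrite !map_cat; apply: Mop1_cancel; try exact: sylX.
  by rewrite -gen_valM st1 (morph_1 gen_valM).
- move=> m Ys Yt m2 st lst; rewrite !map_cat !map_alternating.
  have E r r' : weval (alternating (val r) (val r') m) =
      val (weval (alternating (r : gen_group Y) r' m)).
    by rewrite (morph_weval gen_valM) map_alternating.
  apply: Mop2_swap => //; [exact: sylX|exact: sylX|by rewrite !E st|].
  by rewrite E -slength_val.
Qed.

Lemma reduced_val w : reduced Y' w <-> reduced X (map val w).
Proof. by rewrite /reduced size_map slength_val (morph_weval gen_valM). Qed.

Lemma Mreduced_val w : syllabic Y' w -> Mreduced Y' w <-> Mreduced X (map val w).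
Proof.
move=> /syllabic_val Yw; split=> red [w' ww' lt]; apply: red.
  have step v v' : syllabic Y v -> Mop X v v' ->
      syllabic Y v' /\ Mop Y' (map to_gen v) (map to_gen v').
    move=> Yv vv'; split; first exact: Mop_syllabic vv' Yv.
    by case: vv' => vv'; [left; apply: Mop1_to_gen|right; apply: Mop2_to_gen].
  have [_ {}ww'] := clos_refl_trans_map step Yw ww'.
  exists (map to_gen w'); last by rewrite size_map -(size_map val w).
  by rewrite -[w](mapK valK_gen).
have step v v' : True -> Mop Y' v v' -> True /\ Mop X (map val v) (map val v').
  by move=> _ vv'; split=> //; exact: Mop_val.
have [_ {}ww'] := clos_refl_trans_map step I ww'.
by exists (map val w'); rewrite ?size_map.
Qed.

Lemma parabolic_property_D : property_D Y'.
Proof.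
split=> [w Yw|w w' Yw Yw' red red' ww'].
  have Xw : syllabic X (map val w) by apply/syllabic_sub/syllabic_val.
  by rewrite reduced_val Mreduced_val //; exact: hD.1.
have Yv := (syllabic_val w).1 Yw; have Yv' := (syllabic_val w').1 Yw'.
have vv' : clos_refl_trans _ (Mop2 X) (map val w) (map val w').
  apply: hD.2; [exact: syllabic_sub|exact: syllabic_sub| | |].
  - exact/reduced_val.
  - exact/reduced_val.
  - by rewrite -!(morph_weval gen_valM) ww'.
have step v v1 : syllabic Y v -> Mop2 X v v1 ->
    syllabic Y v1 /\ Mop2 Y' (map to_gen v) (map to_gen v1).
  by move=> Yv1 vv1; split; [exact: Mop2_syllabic vv1 Yv1|exact: Mop2_to_gen].
have [_] := clos_refl_trans_map step Yv vv'.
by rewrite !(mapK valK_gen).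
Qed.

Lemma parabolic_strongly_marked : strongly_marked Y'.
Proof.
have [_ X1 strong] := hX; split.
- by apply/seteqP; split=> // g _; exact: gen_gen_set.
- by move=> Y1; apply: X1; rewrite -(morph_1 gen_valM); exact: YX.
have gen_val1 (g s : gen_group Y) : gen [set g] s -> gen [set val g] (val s).
  move: s; apply: gen_smallest => [|h k Hh Hk|h ->].
  - by have := @gen1 _ [set val g]; rewrite -(morph_1 gen_valM).
  - have := genF (Hh : gen _ (val h)) (Hk : gen _ (val k)).
    by rewrite -(morph_V gen_valM) -gen_valM.
  - exact: sub_gen.
have val1 (s : gen_group Y) : s <> 1 -> val s <> 1.
  by move=> s1 E; apply/s1/val_inj; rewrite E (morph_1 gen_valM).
move=> g h s t Yg Yh gs s1 ht t1 st; apply: val_inj.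
apply: (strong _ _ (val s) (val t)); [exact: YX|exact: YX| | | | |].
- exact: gen_val1.
- exact: val1.
- exact: gen_val1.
- exact: val1.
- rewrite -gen_valM; case: st => [/syllable_val/syllable_sub|->]; first by left.
  by right; exact: (morph_1 gen_valM).
Qed.
End Parabolic.

(** * The presentation of the subgroup *)

Section Presentation.
Variables (G : groupType) (X : set G) (V : Type) (Gamma : qd_graph V).
Variables (x : V -> G) (U : set V).
Hypotheses (hX : strongly_marked X) (hD : property_D X).
Hypothesis hQD : qd_presentation Gamma X x.
Local Notation Y := (x @` U).
Local Notation Q := (QD (qd_restrict Gamma U)).
Local Notation y := (qd_gen (qd_restrict Gamma U)).

Lemma parabolic_sub : Y `<=` X.
Proof. by case: hQD => -> _ _ [v _ <-]; exists v. Qed.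

Lemma presentation_relations : qd_relations Gamma x.
Proof.
have [_ [phi [_ phix]]] := hQD.
have -> : x = phi \o qd_gen Gamma by apply/funext => v; rewrite /= phix.
exact: morph_qd_relations (@gmulfM _ _ phi) (qd_gen_relations Gamma).
Qed.

Lemma presentation_inverse : exists2 psi : G -> QD Gamma,
  {morph psi : g h / g * h} & forall v, psi (x v) = qd_gen Gamma v.
Proof.
have [_ [phi [[psi phiK psiK] phix]]] := hQD; exists psi.
  exact: can2_gmulfM phiK psiK.
by move=> v; rewrite -phix phiK.
Qed.

Lemma generator_zexp_inj u v a b :
  zexp (x u) a = zexp (x v) b -> zexp (x u) a <> 1 -> u = v.
Proof.
have [_ [phi [_ phix]]] := hQD; have [psi psiM psix] := presentation_inverse.
move=> E neq; apply: (@qd_gen_zexp_inj _ Gamma u v a b).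
  by rewrite -!psix -!(morph_zexp psiM) E.
move=> E1; apply: neq; rewrite -phix -(morph_zexp (@gmulfM _ _ phi)) E1.
exact: (morph_1 (@gmulfM _ _ phi)).
Qed.

Lemma generator_inj u v : x u = x v -> u = v.
Proof.
move=> E; apply: (@generator_zexp_inj u v 1%R 1%R) => //.
have [_ X1 _] := hX; rewrite zexp_nat expg1 => xu1; apply: X1.
by case: hQD => -> _; exists u.
Qed.

Lemma parabolic_syllable s : syllable Y s <->
  exists (u : U) a, s = zexp (x (val u)) a /\ s <> 1.
Proof.
split=> [/syllableE[_ [a [[u Uu <-] sE s1]]]|[u [a [sE s1]]]].
  by exists (SigSub (mem_set Uu)), a.
by apply/syllableE; exists (x (val u)), a; split=> //; exact/imageP/set_valP.
Qed.

(** No multiplicativity is claimed: [lift] is well defined because a nontrivial power determines its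
    vertex, and exponents giving the same power in [G] give the same power in [Q]. *)
Lemma syllable_lift : exists lift : G -> Q,
  forall (u : U) a, lift (zexp (x (val u)) a) = zexp (y u) a.
Proof.
have [psi psiM psix] := presentation_inverse.
have yR := qd_gen_relations (qd_restrict Gamma U).
have E (u : U) a b : zexp (x (val u)) a = zexp (x (val u)) b ->
    zexp (y u) a = zexp (y u) b.
  move=> ab; apply: (zexp_restrict yR).
  by rewrite -!psix -!(morph_zexp psiM) ab.
suff /choice[lift liftP] s : exists k : Q, forall (u : U) a,
    s = zexp (x (val u)) a -> zexp (y u) a = k.
  by exists lift => u a; exact/esym/liftP.
have [[u [a sE]]|no] := pselect (exists (u : U) a, s = zexp (x (val u)) a).
  exists (zexp (y u) a) => v b sE'.
  (* The trivial element may be a power of several generators, but then all candidate values are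
     [1]. *)
  have [s1|s1] := pselect (s = 1).
    have one (w : U) c : s = zexp (x (val w)) c -> zexp (y w) c = 1.
      by move=> wc; apply: (E w c 0%R); rewrite -wc s1.
    by rewrite (one _ _ sE) (one _ _ sE').
  have uv : u = v.
    by apply/val_inj/(@generator_zexp_inj _ _ a b); rewrite -sE.
  by subst v; apply: E; rewrite -sE.
by exists 1 => u a sE; case: no; exists u, a.
Qed.

(** Type I operations add exponents of a single generator; type II operations between distinct
    generators are covered by [alternating_restrict]. *)
Lemma lift_Mop (lift : G -> Q) w w' :
  (forall (u : U) a, lift (zexp (x (val u)) a) = zexp (y u) a) ->
  syllabic Y w -> Mop X w w' -> weval (map lift w) = weval (map lift w').
Proof.
move=> liftE Yw [] ww'; case: ww' Yw => {w w'} w1 w2 s t.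
- move=> _ _ Xst _ /syllabic_cat[_] /syllabic_cons[Ys] /syllabic_cons[Yt _].
  have /parabolic_syllable[u [a [stE st1]]] :=
    syllable_mul hX parabolic_sub Ys Yt Xst.
  have /parabolic_syllable[v [b [sE s1]]] := Ys.
  have /parabolic_syllable[w [c [tE t1]]] := Yt.
  have vw : v = w.
    have [_ _ strong] := hX; apply/val_inj/generator_inj.
    apply: (strong _ _ s t) => //; last by left.
    + by apply: parabolic_sub; exact/imageP/set_valP.
    + by apply: parabolic_sub; exact/imageP/set_valP.
    + by rewrite sE; exact: gen_zexp (sub_gen _).
    + by rewrite tE; exact: gen_zexp (sub_gen _).
  rewrite !map_cat !weval_cat /= !weval_cons weval_nil !mulg1.
  by rewrite tE -vw sE -zexpD !liftE zexpD !mulgA.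
- move=> _ _ st1 /syllabic_cat[_] /syllabic_cons[Ys] /syllabic_cons[Yt _].
  have /parabolic_syllable[v [b [sE s1]]] := Ys.
  have tE : t = zexp (x (val v)) (- b)%R.
    by rewrite zexpN -sE; exact/esym/mulg1_eq.
  rewrite !map_cat !weval_cat /= !weval_cons weval_nil mulg1.
  by rewrite tE sE !liftE zexpN mulgV mul1g.
- move=> m _ _ m2 st lst /syllabic_cat[_].
  move=> /syllabic_cat[/(syllabic_alternating_inv m2)[Ys Yt] _].
  rewrite !map_cat !weval_cat !map_alternating; congr (_ * (_ * _)).
  have /parabolic_syllable[u [a [sE s1]]] := Ys.
  have /parabolic_syllable[v [b [tE t1]]] := Yt.
  rewrite sE tE !liftE.
  (* Powers of one generator commute, so unless they are equal [m] is even and the two products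
     agree in [Q] as well. *)
  have [uv|uv] := pselect (val u = val v).
    have {}uv : u = v by exact: val_inj.
    subst v; have [ab|ab] := pselect (s = t).
      by rewrite -!liftE -sE -tE ab.
    apply: even_alternating_commute; first exact: commute_zexp.
    apply: commute_alternating ab st; rewrite sE tE; exact: commute_zexp.
  have [psi psiM psix] := presentation_inverse.
  have psi1 w c : zexp (x w) c <> 1 -> zexp (qd_gen Gamma w) c <> 1.
    move=> neq E; apply: neq; have [_ [phi [_ phix]]] := hQD.
    rewrite -phix -(morph_zexp (@gmulfM _ _ phi)) E.
    exact: (morph_1 (@gmulfM _ _ phi)).
  apply: (alternating_restrict (qd_gen_relations _) uv).
  + by apply: psi1; rewrite -sE.
  + by apply: psi1; rewrite -tE.
  + exact: ltnW.
  + move: (congr1 psi st); rewrite !(morph_weval psiM) !map_alternating.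
    by rewrite sE tE !(morph_zexp psiM) !psix.
Qed.
Lemma gen_family_relations :
  qd_relations (qd_restrict Gamma U) (gen_family x U).
Proof.
apply: (inj_qd_relations (f := val) (@gen_valM _ Y) val_inj).
have [xf x2 xb] := presentation_relations.
by split=> [v n|u v|u v p q]; [exact: xf|exact: x2|exact: xb].
Qed.

Lemma gen_set_range : gen_set Y = range (gen_family x U).
Proof.
apply/seteqP; split=> [g [u Uu ug]|_ [u _ <-]].
  by exists (SigSub (mem_set Uu)) => //; exact: val_inj.
exact/imageP/set_valP.
Qed.

Section Morphism.
Variable f : Q -> gen_group Y.
Hypotheses (fM : {morph f : g h / g * h}).
Hypothesis fy : forall u, f (y u) = gen_family x U u.

(** A word for [g] becomes a word over [Y] with value [1] in [G]. M-operations take it to the empty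
    word, and by [lift_Mop] the lifted words keep the value [g] throughout. *)
Lemma parabolic_kernel g : f g = 1 -> g = 1.
Proof.
have [lift liftE] := syllable_lift.
(* Letters are written as powers with exponent [1] or [-1], the form to which [liftE] applies. *)
pose letter (l : U * bool) : G := zexp (x (val l.1)) (if l.2 then 1 else -1)%R.
have letterE l : letter l = if l.2 then x (val l.1) else (x (val l.1))^-1.
  by rewrite /letter; case: l.2; rewrite ?zexpN zexp_nat expg1.
pose w := pres_repr g; pose w' := map letter w.
have gE : g = weval (map lift w').
  rewrite -[g]pres_reprK pres_classE; congr weval; rewrite -map_comp.
  apply: eq_map => l /=; rewrite liftE.
  by case: l.2; rewrite ?zexpN zexp_nat expg1.
have fE : val (f g) = weval w'.
  rewrite -[g]pres_reprK pres_classE (morph_weval fM) -map_comp.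
  rewrite (morph_weval (@gen_valM _ Y)) -map_comp; congr weval.
  apply: eq_map => l /=; rewrite letterE.
  by case: l.2; rewrite ?(morph_V fM) fy // (morph_V (@gen_valM _ Y)).
move=> fg1; rewrite fg1 (morph_1 (@gen_valM _ Y)) in fE.
have Yw' : syllabic Y w'.
  rewrite /w'; elim: (w) => [|l v IHv]; first by [].
  apply/syllabic_cons; split=> //; apply/parabolic_syllable.
  exists l.1, (if l.2 then 1 else -1)%R; split=> //.
  have [_ X1 _] := hX; rewrite letterE => l1; apply: X1.
  suff <- : x (val l.1) = 1 by case: hQD => -> _; exists (val l.1).
  by case: l.2 l1 => // /eqP; rewrite invg_eq1 => /eqP.
have step v v' : syllabic Y v -> Mop X v v' ->
    syllabic Y v' /\ weval (map lift v) = weval (map lift v').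
  move=> Yv vv'; split; last exact: lift_Mop.
  exact: Mop_syllabic hX parabolic_sub _ _ vv' Yv.
have w'0 := Mop_trivial hX hD parabolic_sub Yw' (esym fE).
(* The target relation is equality, so the transported chain collapses to an equality in [Q]. *)
have [_] := clos_refl_trans_map (f := fun v => weval (map lift v)) step Yw' w'0.
rewrite -gE -[RHS](weval_nil Q) => E.
by elim: E => // ? ? ? _ -> _ ->.
Qed.

Lemma parabolic_surjective g : exists k, f k = g.
Proof.
suff /(_ _ (set_mem (valP g)))[k /val_inj] :
  gen Y `<=` [set h | exists k, val (f k) = h] by exists k.
apply: gen_smallest => [|_ _ [h <-] [k <-]|_ [u Uu <-]].
- by exists 1; rewrite (morph_1 fM) (morph_1 (@gen_valM _ Y)).
- exists (h / k).
  by rewrite fM (morph_V fM) (@gen_valM _ Y) (morph_V (@gen_valM _ Y)).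
- by exists (y (SigSub (mem_set Uu))); rewrite fy.
Qed.

Lemma parabolic_bijective : bijective f.
Proof.
(* The right inverse [k] is also a left inverse, since [k (f g) / g] lies in the kernel. *)
have /choice[k kK] := parabolic_surjective; exists k => // g.
apply/divg1_eq/parabolic_kernel.
by rewrite fM (morph_V fM) kK mulgV.
Qed.
End Morphism.

Lemma parabolic_presentation :
  qd_presentation (qd_restrict Gamma U) (gen_set Y) (gen_family x U).
Proof.
split; first exact: gen_set_range.
have [f fM fy] := qd_hom gen_family_relations.
pose phi : {multiplicative Q -> gen_group Y} :=
  HB.pack f (isMultiplicative.Build Q (gen_group Y) f fM).
by exists phi; split=> //; exact: parabolic_bijective.
Qed.
End Presentation.

Theorem proposition2p7 (G : groupType) (X : set G)
  (V : Type) (Gamma : qd_graph V) (x : V -> G)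
  (hX : strongly_marked X) (hD : property_D X)
  (hQD : qd_presentation Gamma X x) (U : set V) :
  let Y : set G := x @` U in
  let Y' : set (gen_group Y) := gen_set Y in
  [/\ strongly_marked Y',
      property_D Y'
    & qd_presentation (qd_restrict Gamma U) Y' (gen_family x U)].
Proof.
have YX := parabolic_sub (U := U) hQD; move=> Y Y'; split.
- exact: parabolic_strongly_marked hX YX.
- exact: parabolic_property_D hX hD YX.
- exact: parabolic_presentation hX hD hQD.
Qed.
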